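(* For $n\ge1$ and $k\ge2$ let $$D_k=\frac{1}{n+1}\sum(i_1\,i_2)(i_2\,i_3)\cdots(i_{k-1}\,i_k)(i_k\,i_1)\in\mathbb{C}[S_n],$$ the sum over $(i_1,\dots,i_k)\in\{0,1,\dots,n\}^k$ with $i_j\neq i_{j+1}$ for $1\le j<k$ and $i_k\ne i_1$, where a transposition $(a\,b)$ with $a=0$ or $b=0$ is interpreted as the identity. Write $D_k=\sum_\lambda N_\lambda[D_k](n)\,\hat\Sigma_{\lambda,n}$. Then: (i) $N_\lambda[D_k](n)=0$ unless $\lambda=\mathrm{Rem}_k(\mu)$ for some $\mu\in\bar{\mathbb{Y}}_k$; (ii) for fixed $k$ and $\lambda=\mathrm{Rem}_k(\mu)$ with $\mu\in\bar{\mathbb{Y}}_k$, as $n\to\infty$, $$N_\lambda[D_k](n)=|\mathrm{NC}(\mu)|\,n^{\frac{l(\lambda)+k}{2}}\big(1+O(n^{-1})\big).$$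
   Context: $\bar{\mathbb{Y}}_k$ is the set of partitions of $k$ all of whose parts are $\ge2$. For a partition $\lambda$ with parts $\ge2$ (possibly empty), $|\lambda|$ is its size, $\ell(\lambda)$ its number of parts and $l(\lambda)=|\lambda|-\ell(\lambda)$. $\mathrm{Rem}_k:\bar{\mathbb{Y}}_k\to\{\text{partitions with parts}\ge2\}$ removes all parts equal to $2$ and then subtracts $1$ from each remaining part (removes the first column); it is injective. For $\lambda$ with parts $\ge2$ and $|\lambda|\le n$, $\Sigma_{\lambda,n}=\sum(a_{1,1}\cdots a_{1,\lambda_1})\cdots(a_{\ell,1}\cdots a_{\ell,\lambda_\ell})$ over all choices of pairwise distinct $a_{p,q}\in\{1,\dots,n\}$, and $\hat\Sigma_{\lambda,n}=\Sigma_{\lambda,n}/(n(n-1)\cdots(n-|\lambda|+1))$ ($\hat\Sigma_{\emptyset,n}=e$); these form a basis of the center of $\mathbb{C}[S_n]$, and $N_\lambda[x](n)$ denotes the coefficient of $\hat\Sigma_{\lambda,n}$ in a central element $x$ (equivalently, the sum of the coefficients of $x$ on permutations whose cycles of length $\ge2$ have lengths given by $\lambda$). For $\mu\in\bar{\mathbb{Y}}_k$, $\mathrm{NC}(\mu)$ is the set of non-crossing set partitions of $\{1,\dots,k\}$ whose multiset of block sizes is $\mu$. *)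

(* Defs.v *)
From HB Require Import structures.
From mathcomp Require Import all_boot all_order all_algebra all_fingroup.
From mathcomp Require Import reals.

Set Implicit Arguments.
Unset Strict Implicit.
Unset Printing Implicit Defensive.

Import Order.TTheory GRing.Theory Num.Theory.

Definition is_part2 (l : seq nat) : bool :=
  sorted geq l && all (fun x => 1 < x) l.

Definition Ybar (k : nat) (mu : seq nat) : bool := is_part2 mu && (sumn mu == k).

Definition Rem (mu : seq nat) : seq nat := [seq x.-1 | x <- mu & x != 2].

Definition psize (l : seq nat) : nat := sumn l.
Definition plength (l : seq nat) : nat := size l.
Definition pl (l : seq nat) : nat := psize l - plength l.

Definition cycle_type2 (n : nat) (s : 'S_n) : seq nat :=
  sort geq (map (fun X : {set 'I_n} => #|X|)
    (filter (fun X : {set 'I_n} => 1 < #|X|) (enum (porbits s)))).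

(* Permutations of {1,...,n} are 'S_n, the point i of {1..n} being the
   ordinal i-1.  Indices i_j range over {0,...,n} = 'I_n.+1; the
   "transposition" (a b) is the identity if a = 0 or b = 0. *)
Definition tr0 (n : nat) (a b : 'I_n.+1) : 'S_n :=
  match unlift ord0 a, unlift ord0 b with
  | Some a', Some b' => tperm a' b'
  | _, _ => 1%g
  end.

Definition admissible (n k : nat) (i : {ffun 'I_k -> 'I_n.+1}) : bool :=
  [forall j : 'I_k, i j != i (ordS j)].

Definition cyc_prod (n k : nat) (i : {ffun 'I_k -> 'I_n.+1}) : 'S_n :=
  (\prod_(j < k) tr0 (i j) (i (ordS j)))%g.

(* D_k as an element of the group algebra Q[S_n] (subset of C[S_n]),
   given by its coefficient function on permutations. *)
Definition Dk (n k : nat) : {ffun 'S_n -> rat} :=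
  [ffun s => (#|[set i : {ffun 'I_k -> 'I_n.+1} | admissible i && (cyc_prod i == s)]|%:R
              / (n.+1)%:R)%R].

(* N_lambda[x](n): coefficient of \hat\Sigma_{lambda,n} in a central element x,
   i.e. the sum of the coefficients of x on the permutations of cycle type lambda. *)
Definition Ncoef (n : nat) (lam : seq nat) (x : {ffun 'S_n -> rat}) : rat :=
  (\sum_(s : 'S_n | cycle_type2 s == lam) x s)%R.

Definition noncrossing (k : nat) (P : {set {set 'I_k}}) : bool :=
  [forall B1 in P, forall B2 in P, (B1 != B2) ==>
    [forall a : 'I_k, forall b : 'I_k, forall c : 'I_k, forall d : 'I_k,
      ~~ [&& (a < b)%N, (b < c)%N, (c < d)%N,
             a \in B1, c \in B1, b \in B2 & d \in B2]]].

Definition block_sizes (k : nat) (P : {set {set 'I_k}}) : seq nat :=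
  sort geq (map (fun B : {set 'I_k} => #|B|) (enum P)).

Definition NC (k : nat) (mu : seq nat) : {set {set {set 'I_k}}} :=
  [set P : {set {set 'I_k}} | [&& partition P [set: 'I_k], noncrossing P
                                 & block_sizes P == mu]].

(* Main.v *)
Require Import Defs.
From HB Require Import structures.
From mathcomp Require Import all_boot all_order all_algebra all_fingroup.
From mathcomp Require Import reals.
From mathcomp Require Import zify.
Import Order.TTheory GRing.Theory Num.Theory.

Set Implicit Arguments.
Unset Strict Implicit.
Unset Printing Implicit Defensive.

(** A closed walk i is sorted by its kernel, encoded as the permutation p of the times
    sending each time to the next (cyclic) visit of the same vertex.  With c the cyclic
    shift, the product of the transpositions is, up to fixed points, the first-return map
    of sigma = c^-1 p to its set of descents; so its cycle type is read off from the
    numbers of descents of the cycles of sigma.  The walk being non-constant at each step,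
    sigma has no fixed point, and a cycle C of sigma has between 1 and |C| - 1 descents:
    this gives (i) and bounds the number b of visited vertices, hence the exponent of n.
    The bound on b is attained iff every cycle of sigma has a single ascent, i.e. iff the
    cycles of sigma form a non-crossing partition whose Kreweras complement is the kernel.
    Walks through 0 may be rotated to start at 0; they then have the cycle type of a genuine
    product of transpositions in S_{n+1}, and contribute only to lower order. *)

(** * Next visits *)

(** The first later time in the class of [j] if there is one, otherwise the earliest time of the
    class; [x0] and [j] only witness that the searches succeed. *)
Definition cnext_fun (T : eqType) (k : nat) (g : 'I_k -> T) (j : 'I_k) : 'I_k :=
  if [pick x : 'I_k | (j < x) && (g x == g j)] is Some x0
  then [arg min_(x < x0 | (j < x) && (g x == g j)) (x : nat)]
  else [arg min_(x < j | g x == g j) (x : nat)].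

Lemma cnext_fun_spec (T : eqType) k (g : 'I_k -> T) j :
  g (cnext_fun g j) = g j /\
  ((j < cnext_fun g j /\ forall u, g u = g j -> j < u -> cnext_fun g j <= u) \/
   (cnext_fun g j <= j /\ forall u, g u = g j -> cnext_fun g j <= u <= j)).
Proof.
rewrite /cnext_fun; case: pickP => [x0 Px0 | no].
  case: arg_minnP => // x /andP[lt_jx /eqP gx] min_x; split=> //; left.
  by split=> // u gu lt_ju; apply: min_x; rewrite lt_ju gu eqxx.
case: arg_minnP => // x /eqP gx min_x; split=> //; right.
split=> [|u gu]; first by apply: min_x.
rewrite min_x ?gu //= leqNgt; apply/negP=> lt_ju.
by have := no u; rewrite lt_ju gu eqxx.
Qed.

(** If [j < j'] lie in one class, the visit after [j] falls above [j] and at most at [j'], whereas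
    the one after [j'] is either beyond [j'] or at most [j]. *)
Lemma cnext_fun_inj (T : eqType) k (g : 'I_k -> T) : injective (cnext_fun g).
Proof.
suff le : forall j j', cnext_fun g j = cnext_fun g j' -> ~ j < j'.
  move=> j j' e; apply: val_inj => /=.
  by have := le _ _ e; have := le _ _ (esym e); lia.
move=> j j' e lt_jj'.
have [gj [[up Hj]|[dn Hj]]] := cnext_fun_spec g j;
  have [gj' [[up' Hj']|[dn' Hj']]] := cnext_fun_spec g j'.
all: have gg : g j' = g j by rewrite -gj' -e gj.
- by have := Hj j' gg lt_jj'; move: up up'; rewrite e; lia.
- by have := Hj' j (esym gg); move: up; rewrite e; lia.
- by have := Hj j' gg; lia.
- by have := Hj j' gg; lia.
Qed.

Definition cnext (T : eqType) k (g : 'I_k -> T) : {perm 'I_k} := perm (@cnext_fun_inj T k g).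

Lemma cnext_same (T : eqType) k (g : 'I_k -> T) j : g (cnext g j) = g j.
Proof. by rewrite permE; case: (cnext_fun_spec g j). Qed.

Lemma cnext_up (T : eqType) k (g : 'I_k -> T) (j u : 'I_k) :
  j < cnext g j -> g u = g j -> j < u -> cnext g j <= u.
Proof.
rewrite permE; case: (cnext_fun_spec g j) => _ [[_ H] _ gu|[]]; first exact: H.
by move=> le _ lt; lia.
Qed.

Lemma cnext_down (T : eqType) k (g : 'I_k -> T) (j u : 'I_k) :
  cnext g j <= j -> g u = g j -> cnext g j <= u <= j.
Proof.
rewrite permE; case: (cnext_fun_spec g j) => _ [[lt _]|[_ H] _]; last exact: H.
by move=> le; lia.
Qed.

Lemma cnext_downS (T : eqType) k (g : 'I_k -> T) (j u : 'I_k) :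
  g u = g j -> j < u -> j < cnext g j.
Proof.
move=> gu lt; rewrite ltnNge; apply/negP => le.
by have := cnext_down le gu; lia.
Qed.

Lemma cnext_uniq (T : eqType) k (g : 'I_k -> T) (q : {perm 'I_k}) :
  (forall j, g (q j) = g j) ->
  (forall j u : 'I_k, j < q j -> g u = g j -> j < u -> q j <= u) ->
  (forall j u : 'I_k, q j <= j -> g u = g j -> q j <= u <= j) ->
  q = cnext g.
Proof.
move=> qs qu qd; apply/permP => j; apply: val_inj => /=.
have [up|dn] := ltnP j (cnext g j).
  have lt : j < q j.
    rewrite ltnNge; apply/negP => le.
    by have := qd j (cnext g j) le (cnext_same g j); lia.
  have := qu _ _ lt (cnext_same g j) up; have := cnext_up up (qs j) lt; lia.
have le : q j <= j by have := cnext_down dn (qs j); lia.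
by have := qd _ _ le (cnext_same g j); have := cnext_down dn (qs j); lia.
Qed.

(** Only coincidences matter, so vertices may be relabelled: lifted from ['I_n] to ['I_n.+1], or
    replaced by orbits of times. *)
Lemma eq_cnext (T T' : eqType) k (g : 'I_k -> T) (g' : 'I_k -> T') :
  (forall j u, (g j == g u) = (g' j == g' u)) -> cnext g = cnext g'.
Proof.
move=> e; have e' j u : g' j = g' u -> g j = g u.
  by move/eqP; rewrite -e => /eqP.
apply: cnext_uniq => [j|j u up|j u dn].
- by apply/eqP; rewrite -e cnext_same.
- by move/e'; apply: cnext_up.
- by move/e'; apply: cnext_down.
Qed.

(** Iterating from the smaller of two times of a class never jumps over the larger one; induction on
    their distance. *)
Lemma cnext_porbitP (T : eqType) k (g : 'I_k -> T) (j u : 'I_k) :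
  (u \in porbit (cnext g) j) = (g u == g j).
Proof.
apply/idP/eqP => [/porbitP[m ->]|].
  by elim: m => [|m IH]; rewrite ?expg0 ?perm1 // expgSr permM cnext_same.
suff up: forall (u j : 'I_k), j <= u -> g u = g j -> u \in porbit (cnext g) j.
  move=> e; case/orP: (leq_total j u) => le; first exact: up.
  by rewrite porbit_sym up.
move=> {}u {}j.
have [d] := ubnP (u - j); elim: d j => // d IH j ltd le e.
have [->|ne] := eqVneq u j; first exact: porbit_id.
have lt : j < u by move: ne; rewrite -val_eqE /=; lia.
have up := cnext_downS e lt.
have le' := cnext_up up e lt.
have: u \in porbit (cnext g) (cnext g j) by apply: IH; rewrite ?cnext_same //; lia.
by have := porbit_perm (cnext g) 1 j; rewrite expg1 => ->.
Qed.

(** Hence [p = cnext (porbit p)] characterises the permutations that encode a kernel. *)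
Lemma cnext_porbit (T : eqType) k (g : 'I_k -> T) : cnext (porbit (cnext g)) = cnext g.
Proof.
apply: eq_cnext => j u; rewrite eq_porbit_mem cnext_porbitP.
by [].
Qed.

Lemma porbit_step (T : finType) (s : {perm T}) j : porbit s (s j) = porbit s j.
Proof. by have := porbit_perm s 1 j; rewrite expg1. Qed.

(* In an orbit with a single descent, an element u strictly between j and q j would
   yield, taken minimal, a smaller j' = q^-1 u with j strictly between j' and q j'. *)
Lemma one_descent_cnext k (q : {perm 'I_k}) :
  (forall x y : 'I_k, q x <= x -> q y <= y -> y \in porbit q x -> x = y) ->
  q = cnext (porbit q).
Proof.
move=> one.
have mx (j : 'I_k) : q j <= j -> forall u, u \in porbit q j -> u <= j.
  move=> dj u uj; case: (@arg_maxnP _ u (fun x => x \in porbit q j) val uj).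
  move=> x xj max_x; have dx : q x <= x.
    by apply: max_x; rewrite -eq_porbit_mem porbit_step eq_porbit_mem.
  by rewrite (one j x dj dx xj); apply: max_x.
have mn (j : 'I_k) : q j <= j -> forall u, u \in porbit q j -> q j <= u.
  move=> dj u uj; case: (@arg_minnP _ u (fun x => x \in porbit q j) val uj).
  move=> x xj min_x; have e : q ((q^-1)%g x) = x by rewrite permKV.
  have xj' : (q^-1)%g x \in porbit q j.
    by move: xj; rewrite -!eq_porbit_mem -{1}e porbit_step.
  have dx : q ((q^-1)%g x) <= (q^-1)%g x by rewrite e; apply: min_x.
  by rewrite (one j _ dj dx xj') e; apply: min_x.
have up (j : 'I_k) : j < q j -> forall u, u \in porbit q j -> j < u -> q j <= u.
  have [d] := ubnP (j : nat); elim: d j => // d IH j ltd uj u0 u0j ltu0.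
  rewrite leqNgt; apply/negP => ltu0q.
  pose P x := (x \in porbit q j) && (j < x).
  have Pu0 : P u0 by apply/andP.
  case: (@arg_minnP _ u0 P val Pu0) => u /andP[uo ltju] min_u.
  have {}min_u x : x \in porbit q j -> j < x -> u <= x.
    by move=> *; apply: min_u; apply/andP.
  have ltuq : u < q j by apply: leq_ltn_trans (min_u _ u0j ltu0) _.
  set v := (q^-1)%g u; have e : q v = u by rewrite permKV.
  have vo : v \in porbit q j by move: uo; rewrite -!eq_porbit_mem -{1}e porbit_step.
  have jv : j \in porbit q v by rewrite porbit_sym.
  have [ltv|dv] := ltnP v (q v); last first.
    by have := mn _ dv _ jv; rewrite e; lia.
  have nvj : v != j by apply: contraTneq ltuq => vj; rewrite -e vj ltnn.
  have ltvj : v < j.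
    rewrite ltn_neqAle nvj /= leqNgt; apply/negP => ltjv.
    by have := min_u _ vo ltjv; rewrite e in ltv; lia.
  have := IH v _ ltv j jv ltvj; rewrite e; lia.
apply: cnext_uniq => [j|j u lt e ltu|j u le e]; first exact: porbit_step.
  by apply: up => //; rewrite -e porbit_id.
have uo : u \in porbit q j by rewrite -e porbit_id.
by rewrite (mx _ le _ uo) (mn _ le _ uo).
Qed.

(** * Kreweras complementation and crossings *)

Lemma cprev_same (T : eqType) k (h : 'I_k -> T) (j : 'I_k) : h ((cnext h)^-1 j)%g = h j.
Proof. by rewrite -[in RHS](permKV (cnext h) j) cnext_same. Qed.

Lemma cprev_down (T : eqType) k (h : 'I_k -> T) (j u : 'I_k) :
  ((cnext h)^-1 j)%g < j -> h u = h j -> u < j -> u <= (cnext h)^-1%g j.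
Proof.
move=> lt e ltu; rewrite leqNgt; apply/negP => lt2.
have e2 : h u = h ((cnext h)^-1 j)%g by rewrite cprev_same.
have := @cnext_up _ _ h ((cnext h)^-1 j)%g u; rewrite permKV => /(_ lt e2 lt2); lia.
Qed.

Lemma cprev_up (T : eqType) k (h : 'I_k -> T) (j u : 'I_k) :
  j <= (cnext h)^-1%g j -> h u = h j -> j <= u <= (cnext h)^-1%g j.
Proof.
move=> le e; have := @cnext_down _ _ h ((cnext h)^-1 j)%g u; rewrite permKV cprev_same.
by apply.
Qed.

Definition cshift (k : nat) : {perm 'I_k} := perm (@ordS_inj k).

(** Products compose from left to right: [j] goes to the time just before its next visit,
    cyclically. *)
Definition kreweras k (p : {perm 'I_k}) : {perm 'I_k} := (p * (cshift k)^-1)%g.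

Lemma ordS_val k (j : 'I_k) : (ordS j : nat) = if j.+1 == k then 0 else j.+1.
Proof.
rewrite /=; case: eqP => [->|ne]; first by rewrite modnn.
by rewrite modn_small //; have := ltn_ord j; lia.
Qed.

Lemma krewerasK k (p : {perm 'I_k}) j : ordS (kreweras p j) = p j.
Proof. by rewrite permM -[LHS](permE (@ordS_inj k)) permKV. Qed.

Lemma kreweras_val k (p : {perm 'I_k}) j :
  (kreweras p j : nat) = if (p j : nat) == 0 then k.-1 else (p j).-1.
Proof.
rewrite -(krewerasK p j) ordS_val; have := ltn_ord (kreweras p j).
by case: (_.+1 =P k) => [e _|_ _] //=; rewrite -[in RHS]e.
Qed.

(* Minimal counterexample: replace a by the predecessor of c, so that p c = a + 1 is the
   least element of the p-orbit of c; the largest element z <= b of that orbit then spans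
   a shorter crossing z <= b <= kreweras p z < d. *)
Lemma kreweras_noncrossing (T T' : eqType) k (g : 'I_k -> T) (h : 'I_k -> T') :
  kreweras (cnext g) = (cnext h)^-1%g ->
  forall a b c d : 'I_k, a < b -> b < c -> c < d -> h a = h c -> h b = h d -> h a = h b.
Proof.
move=> es; set p := cnext g in es *; set s := (cnext h)^-1%g in es.
have sE j : (s j : nat) = if (p j : nat) == 0 then k.-1 else (p j).-1.
  by rewrite -es kreweras_val.
have sh j : h (s j) = h j by exact: cprev_same.
move=> a b c d; have [n] := ubnP (c - a); elim: n a b c d => // n IH a b c d ltn ab bc cd eac ebd.
apply/eqP; apply: contraT => /eqP nab.
have dc : s c < c.
  rewrite ltnNge; apply/negP => le; have := cprev_up le eac; lia.
have asc : a <= s c by apply: cprev_down => //; lia.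
have nscb : s c != b by apply: contra_notN nab => /eqP <-; rewrite sh.
have [ltb|geb] := ltnP b (s c).
  by case: nab; apply: (IH a b (s c) d) => //; rewrite ?sh //; lia.
have {geb nscb} scb : s c < b by rewrite ltn_neqAle geb andbT; exact: nscb.
have pc0 : (p c : nat) != 0.
  by apply/eqP => e; have := sE c; rewrite e eqxx; have := ltn_ord d; lia.
have pcE : (p c : nat) = (s c).+1 by have := sE c; rewrite (negbTE pc0); lia.
have pcc : p c <= c by lia.
pose P z := (g z == g c) && (z <= b).
have Ppc : P (p c) by rewrite /P cnext_same eqxx; lia.
case: (@arg_maxnP _ (p c) P val Ppc) => z /andP[/eqP gz zb] max_z.
have /andP[pcz zc] := cnext_down pcc gz.
rewrite -/p in pcz.
have gpz : g (p z) = g c by rewrite cnext_same.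
have zup : z < p z by apply: (cnext_downS (u := c)); [rewrite gz|lia].
have bpz : b < p z.
  rewrite ltnNge; apply/negP => le; have := max_z (p z); rewrite /P gpz eqxx le => /(_ isT).
  by rewrite /=; lia.
have /andP[_ pzc] := cnext_down pcc gpz.
have szE : (s z).+1 = p z.
  have := sE z; case: eqP => [|ne ->]; first by move=> e0; move: zup; rewrite e0.
  by rewrite prednK // lt0n; apply/eqP.
have szz : z <= s z by lia.
have key : h z = h b -> False.
  by move=> e; have := @cprev_up _ _ h z d szz; rewrite e ebd => /(_ erefl); rewrite -/s; lia.
have [zb'|nzb] := eqVneq z b; first by case: key; rewrite zb'.
have [szb|nszb] := eqVneq (s z) b; first by case: key; rewrite -szb sh.
have nzb' : (z : nat) <> b by move/val_inj; apply/eqP.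
have nszb' : (s z : nat) <> b by move/val_inj; apply/eqP.
case: key; apply: (IH z b (s z) d) => //; rewrite ?sh //; lia.
Qed.

(** Whenever [q x <= x], the orbit of [x] under [q] stays between [q x] and [x]. Two such elements
    of an orbit bound each other, hence agree, and [one_descent_cnext] applies. *)
Lemma noncrossing_kreweras_cnext (T : eqType) k (h : 'I_k -> T) :
  (forall a b c d : 'I_k, a < b -> b < c -> c < d -> h a = h c -> h b = h d -> h a = h b) ->
  let q := ((cnext h)^-1 * cshift k)%g in q = cnext (porbit q).
Proof.
move=> nc q; set s := (cnext h)^-1%g.
have qE j : (q j : nat) = if (s j).+1 == k then 0 else (s j).+1.
  by rewrite /q permM permE ordS_val.
have sh j : h (s j) = h j by exact: cprev_same.
suff bd (x : 'I_k) : q x <= x -> forall y, y \in porbit q x -> q x <= y <= x.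
  apply: one_descent_cnext => x y dx dy xy; apply: val_inj => /=.
  have := bd x dx y xy; have := bd y dy x; rewrite porbit_sym => /(_ xy); lia.
move=> dx.
(* A is stable under q, which confines the q-orbit of x to [q x, x]. *)
pose A (z : 'I_k) := [/\ q x <= z, z <= x &
  forall u v : 'I_k, q x <= u -> u < z -> h v = h u -> q x <= v < z].
have A0 : A (q x) by split=> // *; lia.
have step z : A z -> A (q z).
  case=> xz zx cl; have [->//|nzx] := eqVneq z x.
  have {nzx zx} zx : z < x by rewrite ltn_neqAle zx andbT; exact: nzx.
  (* A time of the class of [z] outside this interval would make the class cross that of [x],
     through the pair [s x], [x]. *)
  have out v : h v = h z -> q x <= v < x.
    move=> e; have := qE x; case: eqP => [sk qx0|_ qxs].
      have /(_ z) := @cprev_up _ _ h x; rewrite -/s => U.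
      have lex : x <= s x by have := ltn_ord x; lia.
      rewrite qx0 /= ltnNge; apply/negP => xv.
      have nzx : h z <> h x by move=> e2; have := U lex e2; lia.
      have ltxv : x < v.
        by rewrite ltn_neqAle xv andbT; apply/negP => /eqP/val_inj ev; apply: nzx; rewrite ev.
      have ltvk : v < s x.
        have := ltn_ord v; have : (v : nat) <> s x.
          by move/val_inj => ev; apply: nzx; rewrite -e ev sh.
        by lia.
      by apply: nzx; apply: (nc z x v (s x)); rewrite ?sh.
    have sxx : s x < x by lia.
    have nzx : h z <> h x.
      by move=> e2; have := cprev_down sxx e2 zx; rewrite -/s; lia.
    have nvx : (v : nat) <> x by move/val_inj => ev; apply: nzx; rewrite -e ev.
    have nvsx : (v : nat) <> s x by move/val_inj => ev; apply: nzx; rewrite -e ev sh.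
    have [vl|vg] := ltnP v (s x).
      by case: nzx; rewrite -e; rewrite -(sh x); apply: (nc v (s x) z x); rewrite ?sh //; lia.
    have [vl|vg'] := ltnP v x; first by lia.
    by case: nzx; rewrite -(sh x); apply/esym; apply: (nc (s x) z x v); rewrite ?sh //; lia.
  (* The clause [cl] forbids an earlier time in the class of [z]. So [z] is the least one, its
     cyclic predecessor [s z] is the greatest, and [q z] comes right after [s z]. *)
  have minz v : h v = h z -> z <= v.
    move=> e; rewrite leqNgt; apply/negP => vz.
    by have /andP[xv _] := out v e; have := cl v z xv vz (esym e); lia.
  have zs : z <= s z by apply: minz; rewrite sh.
  have maxz v : h v = h z -> v <= s z.
    by move=> e; have := cprev_up zs e; rewrite -/s; lia.
  have szx := out (s z) (sh z).
  have qzE : (q z : nat) = (s z).+1.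
    by rewrite qE; case: eqP => // e; have := ltn_ord x; lia.
  split; [lia|lia|move=> u v xu uz e].
  have [ltuz|] := ltnP u z; first by have := cl u v xu ltuz e; lia.
  move=> zu; have [ez|nez] := eqVneq (h u) (h z).
    by rewrite ez in e; have := minz v e; have := maxz v e; lia.
  have nuz : (u : nat) <> z by move/val_inj => eu; rewrite eu eqxx in nez.
  have nus : (u : nat) <> s z by move/val_inj => eu; rewrite eu sh eqxx in nez.
  have [vz|zv] := ltnP v z.
    by case/eqP: nez; rewrite -e; apply: (nc v z u (s z)); rewrite ?sh //; lia.
  have [vs|sv] := ltnP (s z) v; last by lia.
  by case/eqP: nez; apply/esym; apply: (nc z u (s z) v); rewrite ?sh //; lia.
move=> y; rewrite -eq_porbit_mem -(porbit_step q x) eq_porbit_mem => /porbitP[m ->].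
suff [-> -> _]: A ((q ^+ m)%g (q x)) by [].
by elim: m => [|m IH]; rewrite ?expg0 ?perm1 // expgSr permM; apply: step.
Qed.

(** * Descents and cycle types *)

Lemma mem_porbits (T : finType) (s : {perm T}) x : porbit s x \in porbits s.
Proof. exact: imset_f. Qed.

Lemma porbits_partition (T : finType) (s : {perm T}) : partition (porbits s) [set: T].
Proof.
apply/and3P; split.
- apply/eqP/setP => x; rewrite inE; apply/bigcupP.
  by exists (porbit s x); [exact: imset_f|exact: porbit_id].
- apply/trivIsetP => A B /imsetP[x _ ->] /imsetP[y _ ->] ne.
  apply/pred0P => z /=; apply/negP => /andP[zx zy]; case/eqP: ne.
  have /eqP <- : porbit s z == porbit s x by rewrite eq_porbit_mem.
  by apply/eqP; rewrite eq_porbit_mem.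
- apply/imsetP => -[x _ e]; suff: x \in (set0 : {set T}) by rewrite inE.
  by rewrite e porbit_id.
Qed.

Lemma card_porbits_sum (T : finType) (s : {perm T}) :
  \sum_(C in porbits s) #|C| = #|T|.
Proof. by rewrite -(card_partition (porbits_partition s)) cardsT. Qed.

Lemma geq_anti : antisymmetric geq.
Proof. by move=> x y; rewrite /=; lia. Qed.

Lemma geq_trans : transitive geq.
Proof. by move=> x y z; rewrite /=; lia. Qed.

Lemma geq_total : total geq.
Proof. by move=> x y; rewrite /=; lia. Qed.

Lemma sorted_geq_eq (s1 s2 : seq nat) :
  sorted geq s1 -> sorted geq s2 -> perm_eq s1 s2 -> s1 = s2.
Proof. exact: sorted_eq geq_trans geq_anti s1 s2. Qed.

(** Common form of cycle types, with [F] the cardinal, and of descent types; dropping the values at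
    most 1 drops the fixed points. *)
Definition big_parts (T : finType) (P : {set T}) (F : T -> nat) : seq nat :=
  sort geq [seq x <- [seq F C | C <- enum P] | 1 < x].

Lemma sumn_big_parts (T : finType) (P : {set T}) F :
  sumn (big_parts P F) = \sum_(C in P | 1 < F C) F C.
Proof.
rewrite (perm_sumn (permEl (perm_sort _ _))) sumnE big_filter big_map.
by rewrite big_enum_cond.
Qed.

Lemma size_big_parts (T : finType) (P : {set T}) F :
  size (big_parts P F) = \sum_(C in P | 1 < F C) 1.
Proof.
rewrite size_sort -sum1_size big_filter big_map.
by rewrite big_enum_cond.
Qed.

Lemma big_parts_imset (T U : finType) (P : {set T}) (h : T -> U) F :
  {in P &, injective h} -> big_parts (h @: P) F = big_parts P (F \o h).
Proof.
move=> hI; apply: sorted_geq_eq; try exact: sort_sorted geq_total _.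
rewrite perm_sort perm_sym perm_sort; apply: perm_filter.
rewrite (map_comp F h); apply: perm_map; apply: uniq_perm.
- by rewrite map_inj_in_uniq ?enum_uniq // => x y; rewrite !mem_enum; exact: hI.
- exact: enum_uniq.
move=> y; rewrite mem_enum; apply/mapP/imsetP => -[x xP ->]; exists x => //.
  by rewrite mem_enum in xP.
by rewrite mem_enum.
Qed.

(** [P] and [Q] may differ in elements of value at most 1, which lets fixed points be ignored. *)
Lemma eq_big_parts (T : finType) (P Q : {set T}) F G :
  (forall C, 1 < F C -> C \in P -> C \in Q) ->
  (forall C, 1 < G C -> C \in Q -> C \in P) ->
  {in P, F =1 G} -> big_parts P F = big_parts Q G.
Proof.
move=> PQ QP eP; rewrite /big_parts; apply: sorted_geq_eq; try exact: sort_sorted geq_total _.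
rewrite perm_sort perm_sym perm_sort.
have -> : [seq F C | C <- enum P] = [seq G C | C <- enum P].
  by apply/eq_in_map => C; rewrite mem_enum; apply: eP.
rewrite !filter_map; apply: perm_map; apply: uniq_perm; try exact: filter_uniq (enum_uniq _).
move=> C; rewrite mem_filter mem_enum mem_filter mem_enum /=.
have [lt|//] := boolP (1 < G C).
by apply/idP/idP => H; [apply: QP|apply: PQ; rewrite ?eP].
Qed.

Definition des k (s : {perm 'I_k}) (C : {set 'I_k}) : nat := #|[set j in C | s j < j]|.

Definition des_type k (s : {perm 'I_k}) : seq nat := big_parts (porbits s) (des s).

Lemma desE k (s : {perm 'I_k}) C : des s C = \sum_(j in C) (s j < j).
Proof. by rewrite /des -sum1dep_card big_mkcondr. Qed.

Lemma sum_des k (s : {perm 'I_k}) :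
  \sum_(C in porbits s) des s C = #|[set j | s j < j]|.
Proof.
under eq_bigr do rewrite desE.
rewrite -(set_partition_big _ (porbits_partition s)) /= -sum1dep_card big_mkcond [RHS]big_mkcond.
by apply: eq_bigr => j _; rewrite inE.
Qed.

(** The largest element of a cycle is a descent and the smallest is not. *)
Lemma des_bounds k (s : {perm 'I_k}) C :
  (forall j, s j != j) -> C \in porbits s -> 0 < des s C < #|C|.
Proof.
move=> nf /imsetP[x _ ->]; have nfv (j : 'I_k) : (s j : nat) <> j.
  by move/val_inj => e; have := nf j; rewrite e eqxx.
have stp y : y \in porbit s x -> s y \in porbit s x.
  by rewrite -!eq_porbit_mem porbit_step.
apply/andP; split.
  case: (@arg_maxnP _ x (fun y => y \in porbit s x) val (porbit_id s x)) => y yx my.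
  apply/card_gt0P; exists y; rewrite inE yx /=.
  by have := my _ (stp _ yx); have := nfv y; rewrite /=; lia.
case: (@arg_minnP _ x (fun y => y \in porbit s x) val (porbit_id s x)) => y yx my.
apply: proper_card; apply/properP; split; first by apply/subsetP => z; rewrite inE => /andP[].
exists y => //; rewrite inE yx /=.
by have := my _ (stp _ yx); have := nfv y; rewrite /=; lia.
Qed.

Lemma des_type_size_bound k (s : {perm 'I_k}) :
  (forall j, s j != j) -> sumn (des_type s) + size (des_type s) <= k.
Proof.
move=> nf; rewrite sumn_big_parts size_big_parts -big_split /=.
rewrite -[X in _ <= X]card_ord -(card_porbits_sum s).
rewrite [X in _ <= X](bigID (fun C => 1 < des s C)) /=.
apply: leq_trans (leq_addr _ _); apply: leq_sum => C /andP[CP _].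
by rewrite addn1; have /andP[_] := des_bounds nf CP.
Qed.

(** Holds cycle by cycle: both sides gain 2 from a cycle with one descent and [2d + 1] from a cycle
    with [d > 1] descents. *)
Lemma sum_desS k (s : {perm 'I_k}) : (forall j, s j != j) ->
  \sum_(C in porbits s) (des s C).+1 + sumn (des_type s) =
  2 * #|[set j | s j < j]| + size (des_type s).
Proof.
move=> nf; rewrite -sum_des sumn_big_parts size_big_parts.
pose A := \sum_(C in porbits s | 1 < des s C) des s C.
pose B := \sum_(C in porbits s | ~~ (1 < des s C)) des s C.
pose N := \sum_(C in porbits s | 1 < des s C) 1.
have -> : \sum_(C in porbits s) des s C = A + B by rewrite (bigID (fun C => 1 < des s C)).
have -> : \sum_(C in porbits s) (des s C).+1 = (A + N) + (B + B).
  rewrite (bigID (fun C => 1 < des s C)) /= -!big_split /=; congr (_ + _).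
    by apply: eq_bigr => C _; rewrite addn1.
  by apply: eq_bigr => C /andP[CP]; have := des_bounds nf CP; lia.
rewrite -/A -/N; lia.
Qed.

(** Visited vertices outnumber descents by one ([card_porbits_cnext]), so this bounds the exponent
    of n. *)
Lemma des_type_bound k (s : {perm 'I_k}) : (forall j, s j != j) ->
  2 * #|[set j | s j < j]| + size (des_type s) <= k + sumn (des_type s).
Proof.
move=> nf; rewrite -sum_desS // leq_add2r -[X in _ <= X]card_ord -(card_porbits_sum s).
by apply: leq_sum => C CP; have /andP[_] := des_bounds nf CP.
Qed.

(** Equality of the sums leaves no slack in any of the bounds [des s C < #|C|]: every cycle has a
    single ascent. *)
Lemma des_type_eq k (s : {perm 'I_k}) : (forall j, s j != j) ->
  2 * #|[set j | s j < j]| + size (des_type s) = k + sumn (des_type s) ->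
  forall C, C \in porbits s -> #|C| = (des s C).+1.
Proof.
move=> nf; rewrite -sum_desS // => /addIn.
rewrite -[X in _ = X]card_ord -(card_porbits_sum s) => e C CP.
apply/eqP; rewrite eqn_leq andbC; have /andP[_ -> /=] := des_bounds nf CP.
rewrite leqNgt; apply/negP => lt.
have : \sum_(C in porbits s) (des s C).+1 < \sum_(C in porbits s) #|C|.
  rewrite (bigD1 C) //= [X in _ < X](bigD1 C) //= -addSn leq_add //.
  by apply: leq_sum => D /andP[DP _]; have /andP[_] := des_bounds nf DP.
by rewrite e ltnn.
Qed.

(** Each class has one time with [p j <= j], its maximum. That time is a descent of the complement,
    except in the class of time 0, where it is sent to the last time instead. *)
Lemma card_porbits_cnext (T : eqType) k (g : 'I_k.+1 -> T) :
  #|porbits (cnext g)| = #|[set j | kreweras (cnext g) j < j]|.+1.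
Proof.
set p := cnext g.
have -> : porbits p = porbit p @: [set j : 'I_k.+1 | p j <= j].
  apply/setP => C; apply/imsetP/imsetP => -[x xT ->]; last by exists x.
  have xx : g x == g x by [].
  case: (@arg_maxnP _ x (fun y => g y == g x) val xx) => y /eqP gy my.
  exists y; last first.
    by apply/eqP; rewrite eq_porbit_mem cnext_porbitP gy.
  rewrite inE; have := my (p y); rewrite cnext_same gy eqxx => /(_ isT) /=; lia.
rewrite card_in_imset; last first.
  move=> x y; rewrite !inE => dx dy /eqP; rewrite eq_porbit_mem cnext_porbitP => /eqP e.
  apply: val_inj => /=.
  by have := cnext_down dx (esym e); have := cnext_down dy e; lia.
rewrite (cardsD1 (p^-1 ord0)%g [set j : 'I_k.+1 | p j <= j]) inE permKV leq0n add1n; congr _.+1.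
apply: eq_card => j; rewrite !inE kreweras_val.
have -> : (j == p^-1 ord0)%g = ((p j : nat) == 0).
  by rewrite -(inj_eq (@perm_inj _ p)) permKV -val_eqE.
by case: eqP => [_|ne] /=; have := ltn_ord j; lia.
Qed.

(** Inverting a cycle with a single ascent gives a cycle with a single descent, to which
    [one_descent_cnext] applies. *)
Lemma des_eq_cnext k (s : {perm 'I_k}) : (forall j, s j != j) ->
  (forall C, C \in porbits s -> #|C| = (des s C).+1) ->
  s = (cnext (porbit s))^-1%g.
Proof.
move=> nf H; apply: invg_inj; rewrite invgK.
have -> : cnext (porbit s) = cnext (porbit s^-1) by apply: eq_cnext => j u; rewrite !porbitV.
apply: one_descent_cnext => x y dx dy xy.
have xy' : y \in porbit s x by rewrite -porbitV.
have C1 : #|[set j in porbit s x | ~~ (s j < j)]| = 1.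
  have := H _ (mem_porbits s x); rewrite /des.
  rewrite -(cardsID [set j | s j < j] (porbit s x)).
  have -> : porbit s x :&: [set j | s j < j] = [set j in porbit s x | s j < j].
    by apply/setP => j; rewrite !inE.
  have -> : porbit s x :\: [set j | s j < j] = [set j in porbit s x | ~~ (s j < j)].
    by apply/setP => j; rewrite !inE andbC.
  by lia.
have in1 (z : 'I_k) : z \in porbit s x -> (s^-1)%g z <= z ->
    (s^-1)%g z \in [set j in porbit s x | ~~ (s j < j)].
  rewrite inE permKV -leqNgt => zx ->; rewrite andbT.
  by move: zx; rewrite -!eq_porbit_mem -porbitV -[in X in _ -> X]porbitV porbit_step.
have /eqP/cards1P[z ez] := C1.
have := in1 x (porbit_id s x) dx; have := in1 y xy' dy.
by rewrite ez !inE => /eqP e1 /eqP e2; apply: (@perm_inj _ s^-1%g); rewrite e1 e2.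
Qed.

(** * The map [Rem] on partitions *)

Lemma sorted_Rem mu : sorted geq mu -> sorted geq (Rem mu).
Proof.
move=> so; rewrite /Rem; apply: (@homo_sorted _ _ predn geq geq).
  by move=> x y /=; lia.
exact: (sorted_filter geq_trans).
Qed.

Lemma Rem_perm (l1 l2 : seq nat) : perm_eq l1 l2 -> perm_eq (Rem l1) (Rem l2).
Proof. by move=> e; apply: perm_map; apply: perm_filter. Qed.

(** Every cycle has one descent fewer than elements; those of length 2 yield the value 1 and are
    dropped. *)
Lemma des_type_Rem k (s : {perm 'I_k}) : (forall j, s j != j) ->
  (forall C, C \in porbits s -> #|C| = (des s C).+1) ->
  des_type s = Rem (block_sizes (porbits s)).
Proof.
move=> nf H; apply: sorted_geq_eq; first exact: sort_sorted geq_total _.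
  by apply: sorted_Rem; apply: sort_sorted geq_total _.
rewrite perm_sort perm_sym.
apply: perm_trans (Rem_perm (permEl (perm_sort _ _))) _.
have -> : [seq des s C | C <- enum (porbits s)] =
    map predn (map (fun B : {set 'I_k} => #|B|) (enum (porbits s))).
  by rewrite -map_comp; apply/eq_in_map => C; rewrite mem_enum /= => /H ->.
set L := map (fun B : {set 'I_k} => #|B|) _; rewrite /Rem filter_map.
suff -> : [seq x <- L | x != 2] = [seq x <- L | preim predn (fun x => 1 < x) x].
  exact: perm_refl.
apply: eq_in_filter => x /mapP[C].
rewrite mem_enum => CP ->; have /andP[d0 _] := des_bounds nf CP.
by rewrite (H _ CP) /=; lia.
Qed.

Lemma Rem_decomp k mu : Ybar k mu ->
  perm_eq mu (map succn (Rem mu) ++ nseq (count (pred1 2) mu) 2).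
Proof.
case/andP=> /andP[_ /allP ge2] _.
rewrite /Rem -map_comp.
rewrite -(perm_filterC (fun x => x != 2) mu); apply: perm_cat.
  set L := filter _ _; suff -> : [seq (succn \o predn) x | x <- L] = L by exact: perm_refl.
  rewrite -[RHS]map_id; apply/eq_in_map => x.
  by rewrite mem_filter => /andP[_ /ge2]; rewrite /=; lia.
have -> : [seq x <- mu | predC (fun x => x != 2) x] = [seq x <- mu | pred1 2 x].
  by apply: eq_filter => x /=; rewrite negbK.
rewrite -size_filter; set L := filter _ _; have e : L = nseq (size L) 2.
  by apply/all_pred1P; rewrite all_filter; apply/allP => x _; apply/implyP.
by rewrite {1}e perm_refl.
Qed.

Lemma sumn_map_succn l : sumn (map succn l) = sumn l + size l.
Proof. by elim: l => //= x l ->; lia. Qed.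

Lemma Rem_sum k mu : Ybar k mu ->
  k = sumn (Rem mu) + size (Rem mu) + 2 * count (pred1 2) mu /\
  size mu = size (Rem mu) + count (pred1 2) mu.
Proof.
move=> Y; have pe := Rem_decomp Y; split.
  case/andP: Y => _ /eqP <-.
  by rewrite (perm_sumn pe) sumn_cat sumn_nseq sumn_map_succn.
by rewrite (perm_size pe) size_cat size_nseq size_map.
Qed.

(** The size [k] determines how many parts 2 were deleted, by [Rem_sum]. *)
Lemma Rem_inj k mu mu' : Ybar k mu -> Ybar k mu' -> Rem mu = Rem mu' -> mu = mu'.
Proof.
move=> Y Y' e; have [e1 _] := Rem_sum Y; have [e2 _] := Rem_sum Y'.
apply: sorted_geq_eq; try by case/andP: (Y) => /andP[].
  by case/andP: (Y') => /andP[].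
apply: perm_trans (Rem_decomp Y) _; rewrite perm_sym.
apply: perm_trans (Rem_decomp Y') _; rewrite -e in e2 *.
by have -> : count (pred1 2) mu = count (pred1 2) mu' by lia.
Qed.

(** Restore the first column and fill the even slack with [m] parts equal to 2. *)
Lemma Rem_exists k lam m : is_part2 lam -> sumn lam + size lam + 2 * m = k ->
  exists2 mu, Ybar k mu & lam = Rem mu.
Proof.
case/andP=> so ge2 e; exists (map succn lam ++ nseq m 2); last first.
  rewrite /Rem filter_cat map_cat.
  rewrite (_ : filter _ (nseq m 2) = [::]); last by elim: (m).
  rewrite cats0 filter_map -map_comp.
  rewrite -[LHS]map_id; rewrite (_ : filter _ lam = lam); first exact: eq_map.
  by apply/all_filterP/allP => x /(allP ge2) /=; lia.
rewrite /Ybar sumn_cat sumn_map_succn sumn_nseq e eqxx andbT /is_part2 all_cat.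
apply/andP; split; last first.
  apply/andP; split; last by apply/allP => x /nseqP[->].
  by rewrite all_map; apply/allP => x /(allP ge2) /=; lia.
move: so ge2; clear e; elim: lam => [_ _|x l IH /=].
  by elim: m => //= -[|m] IH.
move=> pa /andP[gx al].
move: (pa) => /path_sorted so; move: (IH so al); case: l pa al {IH so} => [|y l] /=.
  by case: m => //= m _ _ ->; rewrite andbT; lia.
by move=> /andP[/= xy _] _ ->; rewrite andbT; lia.
Qed.

(** * Products of transpositions along closed walks *)

(** Through [f], [W] is the first-return map of [s] to [M]. A first return never overshoots a marked
    point further along the orbit, so induction on the exponent reaches all marked points. *)
Lemma porbit_return (S V : finType) (s : {perm S}) (M : pred S) (f : S -> V) (W : {perm V}) :
  (forall j, M j -> exists n, [/\ 0 < n, W (f j) = f ((s ^+ n)%g j), M ((s ^+ n)%g j)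
     & forall n', 0 < n' < n -> ~~ M ((s ^+ n')%g j)]) ->
  forall j, M j -> porbit W (f j) = f @: [set u in porbit s j | M u].
Proof.
move=> ret j Mj; apply/setP => y; apply/idP/imsetP.
  case/porbitP => m ->; elim: m => [|m [u]].
    by exists j; rewrite ?expg0 ?perm1 // inE porbit_id.
  rewrite inE => /andP[uj Mu] e.
  have [n [n0 eW Mn _]] := ret u Mu; exists ((s ^+ n)%g u).
    by rewrite inE Mn andbT -eq_porbit_mem porbit_perm eq_porbit_mem.
  by rewrite expgSr permM e eW.
case=> u; rewrite inE => /andP[/porbitP[m ->] Mu] ->.
elim/ltn_ind: m j Mj Mu => m IH j Mj Mu.
have [->|m0] := posnP m; first by rewrite expg0 perm1 porbit_id.
have [n [n0 eW Mn nM]] := ret j Mj.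
have le : n <= m.
  by rewrite leqNgt; apply/negP => lt; have := nM m; rewrite m0 lt Mu => /(_ isT).
have sm : (s ^+ (m - n))%g ((s ^+ n)%g j) = (s ^+ m)%g j.
  by rewrite -permM -expgD subnKC.
rewrite -sm in Mu *; rewrite -eq_porbit_mem -(porbit_step W (f j)) eW eq_porbit_mem.
by apply: IH => //; lia.
Qed.

Definition walk_prod (V : finType) k (g : 'I_k -> V) : {perm V} :=
  (\prod_(j < k) tperm (g j) (g (ordS j)))%g.

Definition ctype (V : finType) (W : {perm V}) : seq nat :=
  big_parts (porbits W) (fun C : {set V} => #|C|).

(** Time is read modulo [k.+1], so that prefix products can run up to the closing step. *)
Definition walk (V : finType) k (g : 'I_k.+1 -> V) (t : nat) : V := g (inord (t %% k.+1)).

Lemma walkE (V : finType) k (g : 'I_k.+1 -> V) (u : 'I_k.+1) : walk g u = g u.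
Proof. by rewrite /walk modn_small // inord_val. Qed.

Lemma walk_last (V : finType) k (g : 'I_k.+1 -> V) : walk g k.+1 = g ord0.
Proof. by rewrite /walk modnn; congr g; apply: val_inj; rewrite /= inordK. Qed.

Lemma walkS (V : finType) k (g : 'I_k.+1 -> V) (u : 'I_k.+1) : walk g u.+1 = g (ordS u).
Proof.
by rewrite /walk; congr g; apply: val_inj; rewrite /= inordK // ltn_mod.
Qed.

Definition walk_prefix (V : finType) k (g : 'I_k.+1 -> V) (t : nat) : {perm V} :=
  (\prod_(0 <= j < t) tperm (walk g j) (walk g j.+1))%g.

Lemma walk_prefix_walk_prod (V : finType) k (g : 'I_k.+1 -> V) : walk_prefix g k.+1 = walk_prod g.
Proof.
rewrite /walk_prefix /walk_prod big_mkord; apply: eq_bigr => j _.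
by rewrite walkE walkS.
Qed.

Lemma kreweras_fixfree (T : eqType) k (g : 'I_k -> T) :
  (forall j, g j != g (ordS j)) -> forall j, kreweras (cnext g) j != j.
Proof.
move=> na j; apply/eqP => e; have := krewerasK (cnext g) j; rewrite e => e2.
by have := na j; rewrite e2 cnext_same eqxx.
Qed.

(** From a last visit the next one is the first visit, whose preceding time is smaller unless that
    first visit is at time 0, where it wraps to the last time. *)
Lemma kreweras_desP (T : eqType) k (g : 'I_k.+1 -> T) (j : 'I_k.+1) :
  kreweras (cnext g) j < j <-> (forall u, g u = g j -> u <= j) /\ g j <> g ord0.
Proof.
rewrite kreweras_val; split.
  case: eqP => [_ lt|ne lt]; first by have := ltn_ord j; move: lt; rewrite /=; lia.
  have dn : cnext g j <= j by lia.
  split=> [u e|e]; first by have := cnext_down dn e; lia.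
  by have := cnext_down dn (esym e); rewrite /=; lia.
case=> mx n0; have dn : cnext g j <= j by apply: mx; rewrite cnext_same.
case: eqP => [e|]; last by lia.
case: n0; rewrite -[LHS](cnext_same g j); congr g; exact: val_inj.
Qed.

(* The item initially at [g j] always sits where the walker has been; it is labelled by the
   last (cyclic) time l of the walker's presence there.  It is displaced at time p l, to the
   place of the walker at time p l - 1 = kreweras p l, which becomes the new label. *)
Lemma walk_prefix_track (V : finType) k (g : 'I_k.+1 -> V) (s := kreweras (cnext g)) (j : 'I_k.+1) :
  (forall j, g j != g (ordS j)) -> s j < j ->
  forall t, t <= k.+1 -> exists n, let l := (s ^+ n)%g j in
    [/\ walk_prefix g t (g j) = g l,
        forall n', 0 < n' < n -> ~~ (s ((s ^+ n')%g j) < (s ^+ n')%g j),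
        g l != walk g t
      & if n == 0 then forall u : 'I_k.+1, u <= t -> g u <> g l
        else l < t /\ forall u : 'I_k.+1, l < u -> u <= t -> g u <> g l].
Proof.
move=> na sj; have [mxj nj0] := (kreweras_desP g j).1 sj.
elim=> [_|t IH ltk].
  (* The case [n = 0] means not yet displaced: the label [j] is the last visit of the previous turn,
     and the place is still unvisited. *)
  exists 0; rewrite expg0 perm1; split=> //.
  - by rewrite /walk_prefix big_nil perm1.
  - by case.
  - rewrite -[0]/(nat_of_ord (ord0 : 'I_k.+1)) walkE; exact/eqP.
  - move=> u u0; have -> : u = ord0 by apply: val_inj => /=; lia.
    exact: nesym.
have [n [eW nM ne cond]] := IH (ltnW ltk).
pose tt := Ordinal ltk; have wt : walk g t = g tt by rewrite -walkE.
have wt1 : walk g t.+1 = g (ordS tt) by rewrite -walkS.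
set l := (s ^+ n)%g j in eW ne cond.
have eW1 : walk_prefix g t.+1 (g j) = tperm (walk g t) (walk g t.+1) (g l).
  by rewrite /walk_prefix big_nat_recr //= permM -eW.
have [el|nel] := eqVneq (g l) (walk g t.+1); last first.
  exists n; rewrite -/l; split=> //.
    by rewrite eW1 tpermD // eq_sym.
  have H (u : 'I_k.+1) : u <= t.+1 -> g u = g l -> u <= t.
    move=> le e; rewrite leqNgt; apply/negP => lt; case/eqP: nel.
    have -> : t.+1 = u :> nat by lia.
    by rewrite walkE.
  move: cond; case: eqP => _; first by move=> c u ut e; case: (c u (H u ut e) e).
  by case=> lt c; split=> [|u lu ut e]; [lia|case: (c u lu (H u ut e) e)].
(* The place labelled [l] is next visited at time [t.+1], so [s] sends [l] to [t]. For [t = k] this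
   visit is the one at time 0, and [l] is the last of its class. *)
have slt : s l = tt.
  apply: (@ordS_inj k.+1); rewrite krewerasK; apply: ord_inj; rewrite ordS_val /=.
  rewrite wt1 in el.
  have [ek|nek] := eqVneq t.+1 k.+1.
    have e0 : g ord0 = g l.
      by rewrite el; congr g; apply: ord_inj; rewrite ordS_val /= ek eqxx.
    move: cond; case: eqP => [_ c|_ [lt c]]; first by case: (c ord0).
    have dn : cnext g l <= l.
      rewrite leqNgt; apply/negP => up; apply: (c _ up); last exact: cnext_same.
      by have := ltn_ord (cnext g l); lia.
    by have := cnext_down dn e0; rewrite /=; lia.
  have vt1 : (ordS tt : nat) = t.+1 by rewrite ordS_val (negbTE nek).
  move: cond; case: eqP => [n0 c|_ [lt c]].
    have ej : l = j by rewrite /l n0 expg0 perm1.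
    have dn : cnext g l <= l by rewrite ej; apply: mxj; exact: cnext_same.
    have := cnext_down dn (esym el); rewrite vt1 => /andP[le _].
    have : ~ cnext g l <= t by move=> le2; apply: (c _ le2); exact: cnext_same.
    by lia.
  have lt1 : l < ordS tt by rewrite vt1; lia.
  have up := cnext_downS (esym el) lt1.
  have := cnext_up up (esym el) lt1; rewrite vt1.
  have : ~ cnext g l <= t by move=> le2; apply: (c _ up le2); exact: cnext_same.
  by lia.
exists n.+1; rewrite expgSr permM -/l slt; split=> //.
- by rewrite eW1 el tpermR wt.
- move=> n' /andP[n0' lt]; have [e|nn] := eqVneq n' n; last by apply: nM; lia.
  rewrite e -/l slt /=; move: cond; case: eqP => [n0|_ [lt' _]]; first by lia.
  by rewrite -leqNgt ltnW.
- by rewrite wt1.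
split=> // u /= ltu leu; have -> : u = ordS tt.
  apply: ord_inj; rewrite ordS_val /=; have := ltn_ord u; case: eqP; lia.
by apply/nesym/eqP.
Qed.

(** Tracking to the end: all times have passed, so the label is a last visit, away from the starting
    vertex, i.e. a descent. The item has moved, since its place was visited at time [j]. *)
Lemma walk_prod_return (V : finType) k (g : 'I_k.+1 -> V) (s := kreweras (cnext g)) (j : 'I_k.+1) :
  (forall j, g j != g (ordS j)) -> s j < j ->
  exists n, [/\ 0 < n, walk_prod g (g j) = g ((s ^+ n)%g j),
                s ((s ^+ n)%g j) < (s ^+ n)%g j
              & forall n', 0 < n' < n -> ~~ (s ((s ^+ n')%g j) < (s ^+ n')%g j)].
Proof.
move=> na sj; have [n [eW nM ne cond]] := walk_prefix_track na sj (leqnn _).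
move: cond; case: posnP => [n0|n0].
  by rewrite n0 expg0 perm1 => /(_ j (ltnW (ltn_ord j))).
case=> lt c; exists n; split=> //; first by rewrite -walk_prefix_walk_prod eW.
apply/kreweras_desP; split.
  move=> u e; rewrite leqNgt; apply/negP => ltu; apply: (c u ltu) => //.
  exact: ltnW (ltn_ord u).
by apply/eqP; rewrite walk_last in ne.
Qed.

Lemma walk_prod_out (V : finType) k (g : 'I_k -> V) x :
  (forall j, g j != x) -> walk_prod g x = x.
Proof.
move=> cnext; rewrite /walk_prod; elim/big_ind: _ => [|u v eu ev|j _]; first by rewrite perm1.
  by rewrite permM eu ev.
by rewrite tpermD.
Qed.

(** Taking vertices is injective on descents, so each cycle of [s] yields a cycle of the product
    whose length is its number of descents; all other cycles are trivial. *)
Lemma ctype_walk_prod (V : finType) k (g : 'I_k.+1 -> V) :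
  (forall j, g j != g (ordS j)) -> ctype (walk_prod g) = des_type (kreweras (cnext g)).
Proof.
move=> na; set W := walk_prod g; set s := kreweras (cnext g).
have nf := kreweras_fixfree na.
have ret : forall j : 'I_k.+1, s j < j ->
    porbit W (g j) = g @: [set u in porbit s j | s u < u].
  by apply: porbit_return => j sj; exact: walk_prod_return.
have gI : {in [pred j : 'I_k.+1 | s j < j] &, injective g}.
  move=> x y; rewrite !inE => /kreweras_desP[mx _] /kreweras_desP[my _] e; apply: val_inj => /=.
  by have := mx y (esym e); have := my x e; lia.
pose h (C : {set 'I_k.+1}) := g @: [set u in C | s u < u].
have hP C : C \in porbits s -> exists2 j, s j < j & C = porbit s j.
  move=> CP; have /andP[/card_gt0P[j]] := des_bounds nf CP.
  rewrite inE => /andP[jC sj] _; exists j => //; case/imsetP: CP jC => x _ -> jx.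
  by apply/eqP; rewrite eq_sym eq_porbit_mem.
have hI : {in porbits s &, injective h}.
  move=> C D /hP[j sj ->] /hP[j' sj' ->] e.
  have: g j \in h (porbit s j') by rewrite -e; apply: imset_f; rewrite inE porbit_id.
  case/imsetP => u; rewrite inE => /andP[uj' su] /gI eu.
  by apply/eqP; rewrite eq_porbit_mem eu // ?inE.
transitivity (big_parts (h @: porbits s) (fun C : {set V} => #|C|)).
  apply: eq_big_parts => // C; last first.
    by move=> _ /imsetP[D /hP[j sj ->] ->]; rewrite /h -ret //; exact: mem_porbits.
  move=> C1 /imsetP[x _ eC].
  (* A nontrivial cycle contains a point other than the starting vertex. It is visited, otherwise it
     would be fixed, and its last visit is a descent. *)
  have [y yC yg] : exists2 y, y \in C & y != g ord0.
    have [xg|nxg] := eqVneq x (g ord0); last by exists x; rewrite // eC porbit_id.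
    move: C1; rewrite (cardsD1 x) eC porbit_id add1n ltnS => /card_gt0P[y].
    by rewrite !inE => /andP[yx yo]; exists y; rewrite -?xg.
  have eCy : C = porbit W y.
    by apply/eqP; rewrite eC eq_sym eq_porbit_mem -eC.
  have [j0 /eqP gj0] : exists j, g j == y.
    apply/existsP; apply: contraT => /existsPn no.
    have Wy : W y = y by apply: walk_prod_out.
    have : C \subset [set y].
      rewrite eCy; apply/subsetP => z /porbitP[m ->]; rewrite inE.
      by elim: m => [|m /eqP e]; rewrite ?expg0 ?perm1 // expgSr permM e Wy.
    by move/subset_leq_card; rewrite cards1; lia.
  case: (@arg_maxnP _ j0 (fun u => g u == y) val); first exact/eqP.
  move=> j /eqP gj mj; have sj : s j < j.
    apply/kreweras_desP; split=> [u e|]; first by apply: mj; rewrite e gj.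
    by rewrite gj; apply/eqP.
  by rewrite eCy -gj ret //; apply/imsetP; exists (porbit s j); rewrite ?mem_porbits.
rewrite big_parts_imset //; apply: eq_big_parts => // C CP /=.
rewrite card_in_imset // => x y; rewrite !inE => /andP[_ sx] /andP[_ sy].
by apply: gI; rewrite inE.
Qed.

(** * Parity and bounds for closed walks *)

Lemma odd_walk_prod (V : finType) k (g : 'I_k -> V) :
  (forall j, g j != g (ordS j)) -> odd_perm (walk_prod g) = odd k.
Proof.
move=> na; rewrite /walk_prod (big_morph _ (@odd_permM V) (@odd_perm1 V)).
under eq_bigr do rewrite odd_tperm na.
rewrite -[in RHS](card_ord k) -sum1_card (big_morph odd oddD (erefl : odd 0 = false)).
by [].
Qed.

(** [odd_perm] compares the numbers of points and of cycles; a fixed point adds 1 to both. *)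
Lemma ctype_parity (V : finType) (W : {perm V}) :
  odd (sumn (ctype W) + size (ctype W)) = odd_perm W.
Proof.
rewrite /ctype sumn_big_parts size_big_parts /odd_perm -(card_porbits_sum W) -oddD.
have -> : #|porbits W| = \sum_(C in porbits W | 1 < #|C|) 1 +
    \sum_(C in porbits W | ~~ (1 < #|C|)) 1.
  by rewrite -sum1_card (bigID (fun C : {set V} => 1 < #|C|)).
have -> : \sum_(C in porbits W) #|C| = \sum_(C in porbits W | 1 < #|C|) #|C| +
    \sum_(C in porbits W | ~~ (1 < #|C|)) 1.
  rewrite (bigID (fun C : {set V} => 1 < #|C|)) /=; congr (_ + _).
  apply: eq_bigr => C /andP[/imsetP[x _ ->]]; have := card_porbit_neq0 W x.
  by rewrite -lt0n; lia.
by rewrite !oddD; case: (odd _); case: (odd _); case: (odd _).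
Qed.

(** The first two facts place the type in the image of [Rem]; the third bounds the number of visited
    vertices. *)
Lemma walk_ctype_bounds (V : finType) k (g : 'I_k.+1 -> V) (lam := ctype (walk_prod g)) :
  (forall j, g j != g (ordS j)) ->
  [/\ sumn lam + size lam <= k.+1, odd (sumn lam + size lam) = odd k.+1
    & 2 * #|porbits (cnext g)| + size lam <= k.+1 + 2 + sumn lam].
Proof.
move=> na; have nf := kreweras_fixfree na; split.
- by rewrite /lam ctype_walk_prod //; exact: des_type_size_bound.
- by rewrite ctype_parity odd_walk_prod.
- by rewrite /lam ctype_walk_prod // card_porbits_cnext; have := des_type_bound nf; lia.
Qed.

(** * Walks through 0 *)

Lemma cycle_type2E n (s : 'S_n) : cycle_type2 s = ctype s.
Proof. by rewrite /cycle_type2 /ctype /big_parts filter_map. Qed.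

(** Serves both for extending a permutation by fixed points and, with [f] a permutation, for
    conjugation. *)
Lemma ctype_embed (V V' : finType) (f : V -> V') (s : {perm V}) (s' : {perm V'}) :
  injective f -> (forall x, s' (f x) = f (s x)) ->
  (forall y, (forall x, f x != y) -> s' y = y) -> ctype s' = ctype s.
Proof.
move=> fI fs fix'.
have po x : porbit s' (f x) = f @: porbit s x.
  have pw m : ((s' ^+ m)%g (f x)) = f ((s ^+ m)%g x).
    by elim: m => [|m IH]; rewrite ?expg0 ?perm1 // !expgSr !permM IH fs.
  apply/setP => y; apply/porbitP/imsetP => [[m ->]|[z /porbitP[m ->] ->]].
    by exists ((s ^+ m)%g x); rewrite ?mem_porbit.
  by exists m; rewrite pw.
transitivity (big_parts ((fun C : {set V} => f @: C) @: porbits s) (fun C : {set V'} => #|C|)).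
  apply: eq_big_parts => // C C1.
    move=> /imsetP[y _ eC].
    have [x0 /eqP ex|no] := pickP (fun x => f x == y).
      by apply/imsetP; exists (porbit s x0); rewrite ?mem_porbits // eC -ex po.
    have Wy : s' y = y by apply: fix' => x; rewrite no.
    have : C \subset [set y].
      rewrite eC; apply/subsetP => z /porbitP[m ->]; rewrite inE.
      by elim: m => [|m /eqP e]; rewrite ?expg0 ?perm1 // expgSr permM e Wy.
    by move/subset_leq_card; rewrite cards1; lia.
  by case/imsetP => D /imsetP[x _ ->] ->; rewrite -po mem_porbits.
rewrite big_parts_imset; last by move=> A B _ _; apply: imset_inj.
by apply: eq_big_parts => // C CP /=; rewrite card_imset.
Qed.

Lemma tr0_lift n (a b : 'I_n) : tr0 (lift ord0 a) (lift ord0 b) = tperm a b.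
Proof. by rewrite /tr0 !liftK. Qed.

Lemma tr0_0l n (b : 'I_n.+1) : tr0 ord0 b = 1%g.
Proof. by rewrite /tr0 unlift_none. Qed.

Lemma tr0_0r n (a : 'I_n.+1) : tr0 a ord0 = 1%g.
Proof. by rewrite /tr0 unlift_none; case: (unlift ord0 a). Qed.

Lemma tr0V n (a b : 'I_n.+1) : ((tr0 a b)^-1 = tr0 a b)%g.
Proof.
rewrite /tr0; case: (unlift ord0 a) => [a'|]; last exact: invg1.
by case: (unlift ord0 b) => [b'|]; [exact: tpermV|exact: invg1].
Qed.

Lemma nonzero_lift n k (i : 'I_k -> 'I_n.+1) : (forall j, i j != ord0) ->
  exists g : {ffun 'I_k -> 'I_n}, forall j, i j = lift ord0 (g j).
Proof.
move=> nz; have u j : {x | i j = lift ord0 x}.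
  by case: (unliftP ord0 (i j)) => [x e|e]; [exists x|have := nz j; rewrite e eqxx].
by exists [ffun j => sval (u j)] => j; rewrite ffunE; exact: (svalP (u j)).
Qed.

Lemma cyc_prod_lift n k (g : 'I_k -> 'I_n) (i : {ffun 'I_k -> 'I_n.+1}) :
  (forall j, i j = lift ord0 (g j)) -> cyc_prod i = walk_prod g.
Proof. by move=> e; apply: eq_bigr => j _; rewrite !e tr0_lift. Qed.

Lemma lift_tr0 n (a b : 'I_n.+1) :
  lift_perm ord0 ord0 (tr0 a b) = (if (a == ord0) || (b == ord0) then 1 else tperm a b)%g.
Proof.
case: (unliftP ord0 a) => [a' ->|->]; last by rewrite tr0_0l eqxx lift_perm1.
case: (unliftP ord0 b) => [b' ->|->]; last by rewrite tr0_0r eqxx orbT lift_perm1.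
rewrite tr0_lift ![lift _ _ == _]eq_sym !(negbTE (neq_lift _ _)) /=.
apply/permP => x; case: (unliftP ord0 x) => [x' ->|->].
  rewrite lift_perm_lift; case: (tpermP a' b' x') => [->|->|/eqP na /eqP nb].
  - by rewrite tpermL.
  - by rewrite tpermR.
  by rewrite tpermD // (inj_eq lift_inj) eq_sym.
by rewrite lift_perm_id tpermD // eq_sym neq_lift.
Qed.

(* The prefix products satisfy W_t = P_t (0 i_t), P_t being the product with the
   transpositions (0 b) replaced by the identity. *)
Lemma walk_prod_zero n k (i : {ffun 'I_k.+1 -> 'I_n.+1}) :
  i ord0 = ord0 -> walk_prod i = lift_perm ord0 ord0 (cyc_prod i).
Proof.
move=> i0; rewrite -walk_prefix_walk_prod.
have -> : cyc_prod i = (\prod_(0 <= j < k.+1) tr0 (walk i j) (walk i j.+1))%g.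
  by rewrite big_mkord; apply: eq_bigr => j _; rewrite walkE walkS.
suff H t : walk_prefix i t = (lift_perm ord0 ord0 (\prod_(0 <= j < t) tr0 (walk i j) (walk i j.+1))
    * tperm ord0 (walk i t))%g.
  by rewrite H walk_last i0 tperm1 mulg1.
elim: t => [|t IH].
  rewrite /walk_prefix !big_nil lift_perm1 mul1g.
  by rewrite -[0]/(nat_of_ord (ord0 : 'I_k.+1)) walkE i0 tperm1.
rewrite /walk_prefix big_nat_recr //= -/(walk_prefix i t) IH big_nat_recr //= -(lift_permM _ ord0).
rewrite -!mulgA; congr (_ * _)%g; rewrite lift_tr0.
case: eqP => [->|/eqP a0] /=; first by rewrite tperm1 !mul1g.
case: eqP => [->|/eqP b0] /=; first by rewrite tperm1 tpermC tperm2 mulg1.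
set a := walk i t in a0 *; set b := walk i t.+1 in b0 *.
have [<-|ab] := eqVneq a b; first by rewrite tperm1 mul1g mulg1.
(* For distinct nonzero [a], [b], conjugation by [(a b)] moves the accumulated factor [(0 a)] past
   it and turns it into [(0 b)]. *)
have -> : tperm ord0 b = (tperm ord0 a ^ tperm a b)%g by rewrite tpermJ tpermL tpermD.
by rewrite conjgE tpermV !mulgA tperm2 mul1g.
Qed.

Lemma ctype_lift_perm n (s : 'S_n) : ctype (lift_perm ord0 ord0 s) = ctype s.
Proof.
apply: (@ctype_embed _ _ (lift ord0)) => [|x|y no]; first exact: lift_inj.
  by rewrite lift_perm_lift.
case: (unliftP ord0 y) => [x e|->]; last by rewrite lift_perm_id.
by have := no x; rewrite e eqxx.
Qed.

Lemma ctype_conj (V : finType) (s t : {perm V}) : ctype (s ^ t)%g = ctype s.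
Proof.
apply: (@ctype_embed _ _ t) => [|x|y no]; first exact: perm_inj.
  by rewrite permJ.
by have := no (t^-1 y)%g; rewrite permKV eqxx.
Qed.

Definition rot_walk n k (i : {ffun 'I_k -> 'I_n}) : {ffun 'I_k -> 'I_n} :=
  [ffun j => i (ordS j)].

(** Moving the first factor to the end is conjugation by that factor, an involution. *)
Lemma cyc_prod_rot n k (i : {ffun 'I_k.+1 -> 'I_n.+1}) :
  cyc_prod (rot_walk i) = (cyc_prod i ^ tr0 (i ord0) (i (ordS ord0)))%g.
Proof.
rewrite conjgE tr0V {2}/cyc_prod big_ord_recl !mulgA.
rewrite -{1}(tr0V (i ord0)) mulVg mul1g /cyc_prod big_ord_recr /=; congr (_ * _)%g.
  apply: eq_bigr => j _; rewrite !ffunE.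
  have -> : ordS (widen_ord (leqnSn k) j) = lift ord0 j => //.
  by apply: ord_inj; rewrite ordS_val /= /bump /=; have := ltn_ord j; case: eqP; lia.
have e : ordS ord_max = ord0 :> 'I_k.+1 by apply: ord_inj; rewrite ordS_val /= eqxx.
by rewrite !ffunE e.
Qed.

Lemma rot_to_zero n k (i : {ffun 'I_k.+1 -> 'I_n.+1}) r :
  (forall j, i j != i (ordS j)) -> i r = ord0 ->
  exists g : {ffun 'I_k.+1 -> 'I_n.+1}, [/\ g ord0 = ord0, forall j, g j != g (ordS j),
    ctype (cyc_prod g) = ctype (cyc_prod i) & g @: setT = i @: setT].
Proof.
case: r => r ltr; elim: r ltr i => [|r IH] ltr i na ir.
  by exists i; split=> //; rewrite -ir; congr (i _); apply: val_inj.
have ltr' : r < k.+1 by lia.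
have [||g [g0 nag cg ig]] := IH ltr' (rot_walk i).
- by move=> j; rewrite !ffunE.
- rewrite ffunE -ir; congr (i _); apply: ord_inj; rewrite ordS_val /=.
  by case: eqP; lia.
exists g; split=> //; first by rewrite cg cyc_prod_rot ctype_conj.
rewrite ig; apply/setP => v; apply/imsetP/imsetP => -[x _ ->].
  by exists (ordS x); rewrite ?inE // ffunE.
by exists (ord_pred x); rewrite ?inE // ffunE ord_predK.
Qed.

Lemma card_porbits_image (V : finType) k (g : 'I_k -> V) :
  #|porbits (cnext g)| = #|g @: setT|.
Proof.
have -> : porbits (cnext g) = (fun v => [set j | g j == v]) @: (g @: setT).
  rewrite -imset_comp; apply/setP => C; apply/imsetP/imsetP => -[x _ ->]; exists x => //=.
    by apply/setP => y; rewrite cnext_porbitP inE.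
  by apply/setP => y; rewrite cnext_porbitP inE.
apply: card_in_imset => u v /imsetP[x _ ->] /imsetP[y _ ->] /setP /(_ x).
by rewrite !inE eqxx => /esym/eqP.
Qed.

(** A walk through 0 is rotated to start there and becomes a genuine walk in S_{n+1}; rotation keeps
    the type and the number of visited vertices. *)
Lemma cyc_prod_bounds n k (i : {ffun 'I_k.+1 -> 'I_n.+1}) (lam := cycle_type2 (cyc_prod i)) :
  admissible i ->
  [/\ sumn lam + size lam <= k.+1, odd (sumn lam + size lam) = odd k.+1
    & 2 * #|porbits (cnext i)| + size lam <= k.+1 + 2 + sumn lam].
Proof.
move/forallP => na.
have [r /eqP ir|nz] := pickP (fun r => i r == ord0).
  have [g [g0 nag cg ig]] := rot_to_zero na ir.
  rewrite /lam cycle_type2E -cg -ctype_lift_perm -walk_prod_zero //.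
  by rewrite card_porbits_image -ig -card_porbits_image; exact: walk_ctype_bounds.
have [g eg] : exists g : {ffun 'I_k.+1 -> 'I_n}, forall j, i j = lift ord0 (g j).
  by apply: nonzero_lift => j; rewrite nz.
have -> : cnext i = cnext g by apply: eq_cnext => j u; rewrite !eg (inj_eq lift_inj).
rewrite /lam cycle_type2E (cyc_prod_lift eg); apply: walk_ctype_bounds => j.
by have := na j; rewrite !eg (inj_eq lift_inj).
Qed.

Lemma cyc_prod_nonzero_type n k (i : {ffun 'I_k.+1 -> 'I_n.+1}) :
  admissible i -> (forall j, i j != ord0) ->
  cycle_type2 (cyc_prod i) = des_type (kreweras (cnext i)).
Proof.
move/forallP => na nz.
have [g eg] := nonzero_lift nz.
have -> : cnext i = cnext g by apply: eq_cnext => j u; rewrite !eg (inj_eq lift_inj).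
rewrite cycle_type2E (cyc_prod_lift eg) ctype_walk_prod // => j.
by have := na j; rewrite !eg (inj_eq lift_inj).
Qed.

(** Equal consecutive vertices make the next visit immediate, so the complement fixes that time.
    Admissibility thus depends on the kernel alone. *)
Lemma admissible_kreweras n k (i : {ffun 'I_k -> 'I_n.+1}) :
  admissible i = [forall j, kreweras (cnext i) j != j].
Proof.
apply/forallP/forallP => [na j|nf j]; first exact: kreweras_fixfree.
apply: contra (nf j) => e.
apply/eqP; apply: (@ordS_inj k); rewrite krewerasK.
apply: ord_inj; move/eqP: e => e.
have := ordS_val j; have := ltn_ord j; case: eqP => [ek _ v0|nk lt v].
  rewrite v0; have dn : cnext i j <= j by have := ltn_ord (cnext i j); lia.
  by have := cnext_down dn (esym e); lia.
have lt1 : j < ordS j by rewrite v.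
have up := cnext_downS (esym e) lt1; have := cnext_up up (esym e) lt1.
by rewrite v; lia.
Qed.

(** * Extremal kernels *)

Lemma mem_pblock_partition (T : finType) (nu : {set {set T}}) x y :
  partition nu [set: T] -> (x \in pblock nu y) = (pblock nu x == pblock nu y).
Proof.
case/and3P => /eqP cv tr _; have cx z : z \in cover nu by rewrite cv inE.
by rewrite eq_sym eq_pblock // cx.
Qed.

Lemma porbits_cnext_pblock k (nu : {set {set 'I_k}}) :
  partition nu [set: 'I_k] -> porbits (cnext (pblock nu)) = nu.
Proof.
move=> pnu; have pE j : porbit (cnext (pblock nu)) j = pblock nu j.
  by apply/setP => u; rewrite cnext_porbitP mem_pblock_partition.
case/and3P: pnu => /eqP cv tr n0; apply/setP => C; apply/imsetP/idP => [[x _ ->]|Cnu].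
  by rewrite pE pblock_mem // cv inE.
have [x xC] : exists x, x \in C by apply/set0Pn; apply: contraNneq n0 => <-.
by exists x => //; rewrite pE (def_pblock tr Cnu xC).
Qed.

Lemma noncrossing_porbits k (s : {perm 'I_k}) :
  (forall a b c d : 'I_k, a < b -> b < c -> c < d ->
     porbit s a = porbit s c -> porbit s b = porbit s d -> porbit s a = porbit s b) ->
  noncrossing (porbits s).
Proof.
move=> nc; apply/'forall_implyP => B1 /imsetP[x _ ->].
apply/'forall_implyP => B2 /imsetP[y _ ->]; apply/implyP => ne.
apply/forallP => a; apply/forallP => b; apply/forallP => c; apply/forallP => d.
apply/negP => /and4P[ab bc cd]; rewrite -!eq_porbit_mem.
case/and4P=> /eqP ea /eqP ec /eqP eb /eqP ed; case/eqP: ne.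
by rewrite -ea -eb; apply: (nc a b c d) => //; rewrite ?ea ?eb.
Qed.

Lemma noncrossing_pblock k (nu : {set {set 'I_k}}) :
  partition nu [set: 'I_k] -> noncrossing nu ->
  forall a b c d : 'I_k, a < b -> b < c -> c < d ->
     pblock nu a = pblock nu c -> pblock nu b = pblock nu d -> pblock nu a = pblock nu b.
Proof.
move=> pnu nc a b c d ab bc cd ac bd; apply/eqP; apply: contraT => ne.
case/and3P: (pnu) => /eqP cv tr _.
have pm j : pblock nu j \in nu by rewrite pblock_mem // cv inE.
move/forallP/(_ (pblock nu a))/implyP/(_ (pm a)): nc.
move/forallP/(_ (pblock nu b))/implyP/(_ (pm b))/implyP/(_ ne).
move/forallP/(_ a)/forallP/(_ b)/forallP/(_ c)/forallP/(_ d).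
by rewrite ab bc cd !mem_pblock_partition // ac bd !eqxx.
Qed.

Lemma block_sizes_porbits k (s : {perm 'I_k}) :
  (forall j, s j != j) -> Ybar k (block_sizes (porbits s)).
Proof.
move=> nf; rewrite /Ybar /is_part2; apply/andP; split.
  apply/andP; split; first exact: sort_sorted geq_total _.
  rewrite all_sort; apply/allP => x /mapP[C]; rewrite mem_enum => CP ->.
  by have /andP[d0 d1] := des_bounds nf CP; apply: leq_trans d1.
rewrite /block_sizes (perm_sumn (permEl (perm_sort _ _))) sumnE big_map big_enum.
by rewrite card_porbits_sum card_ord.
Qed.

(** The previous-visit map descends except at the minimum of each block; blocks with at least two
    elements exclude fixed points. *)
Lemma cnext_inv_des k (nu : {set {set 'I_k}}) (s := (cnext (pblock nu))^-1%g) :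
  partition nu [set: 'I_k] -> (forall C, C \in nu -> 1 < #|C|) ->
  (forall j, s j != j) /\ forall C, C \in porbits s -> #|C| = (des s C).+1.
Proof.
move=> pnu big; have nf j : s j != j.
  apply/eqP => sj; have e : cnext (pblock nu) j = j by rewrite -{1}sj permKV.
  case/and3P: (pnu) => /eqP cv tr _.
  have : 1 < #|pblock nu j| by apply: big; rewrite pblock_mem // cv inE.
  suff /subset_leq_card : pblock nu j \subset [set j] by rewrite cards1; lia.
  apply/subsetP => u; rewrite mem_pblock_partition // inE => /eqP eu.
  have dn : cnext (pblock nu) j <= j by rewrite e.
  by apply/eqP/val_inj => /=; have := cnext_down dn eu; rewrite e; lia.
split=> // C CP; apply/eqP; rewrite eqn_leq andbC.
have /andP[_ -> /=] := des_bounds nf CP.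
rewrite -(cardsID [set j | s j < j] C).
have -> : C :&: [set j | s j < j] = [set j in C | s j < j] by apply/setP => j; rewrite !inE.
rewrite -/(des s C) -addn1 leq_add2l.
apply/card_le1_eqP => x y; rewrite !inE -!leqNgt => /andP[ux xC] /andP[uy yC].
have hxy : pblock nu x = pblock nu y.
  case/imsetP: CP xC yC => z _ ->; rewrite /s porbitV !cnext_porbitP => /eqP -> /eqP ->.
  by [].
apply: val_inj => /=.
by have := cprev_up ux (esym hxy); have := cprev_up uy hxy; lia.
Qed.

(* The bijection is p |-> porbits (kreweras p), with inverse nu |-> (cnext (pblock nu))^-1 * cshift. *)
Lemma card_extremal_kreweras k mu : Ybar k.+1 mu ->
  #|[set p : {perm 'I_k.+1} | [&& p == cnext (porbit p), [forall j, kreweras p j != j],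
      des_type (kreweras p) == Rem mu & #|porbits p| == (k.+1 - size mu).+1]]| = #|NC k.+1 mu|.
Proof.
move=> Y; have [sumE sizeE] := Rem_sum Y; set G := [set p | _].
have GP p : p \in G -> [/\ p = cnext (porbit p), forall j, kreweras p j != j,
    kreweras p = (cnext (porbit (kreweras p)))^-1%g,
    forall C, C \in porbits (kreweras p) -> #|C| = (des (kreweras p) C).+1
    & des_type (kreweras p) = Rem mu].
  rewrite inE => /and4P[/eqP pE /forallP nf /eqP dE /eqP bE].
  (* The number of classes prescribed in [G] is the equality case of [des_type_bound]. *)
  have desC : forall C, C \in porbits (kreweras p) -> #|C| = (des (kreweras p) C).+1.
    apply: des_type_eq => //; rewrite dE.
    have := bE; rewrite [in porbits p]pE card_porbits_cnext -pE => -[->].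
    by lia.
  by split=> //; exact: des_eq_cnext.
rewrite -(card_in_imset (f := fun p => porbits (kreweras p))); last first.
  move=> p q /GP[_ _ ep _ _] /GP[_ _ eq _ _] e.
  have ek : kreweras p = kreweras q.
    rewrite ep eq; suff -> : cnext (porbit (kreweras p)) = cnext (porbit (kreweras q)) by [].
    apply: eq_cnext => j u; rewrite !eq_porbit_mem.
    suff -> : porbit (kreweras p) u = porbit (kreweras q) u by [].
    have := mem_porbits (kreweras p) u; rewrite e => /imsetP[z _ ez].
    have : u \in porbit (kreweras q) z by rewrite -ez porbit_id.
    by rewrite ez -eq_porbit_mem => /eqP ->.
  by apply: (mulIg (cshift k.+1)^-1%g).
apply: eq_card => nu; apply/imsetP/idP => [[p /GP[pE nf sE dC dE] ->]|].
  rewrite inE porbits_partition /=; apply/andP; split.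
    apply: noncrossing_porbits; apply: (@kreweras_noncrossing _ _ _ (porbit p)).
    by rewrite -pE.
  apply/eqP; apply: (Rem_inj (block_sizes_porbits nf) Y).
  by rewrite -des_type_Rem.
rewrite inE => /and3P[pnu nc /eqP bs].
have big C : C \in nu -> 1 < #|C|.
  move=> Cnu; case/andP: Y => /andP[_ /allP ge2] _; apply: ge2.
  by rewrite -bs /block_sizes mem_sort; apply/mapP; exists C; rewrite ?mem_enum.
set s := (cnext (pblock nu))^-1%g; have [nf dC] := cnext_inv_des pnu big.
have nuE : porbits s = nu by rewrite porbitsV porbits_cnext_pblock.
pose p := (s * cshift k.+1)%g; have kp : kreweras p = s by rewrite /kreweras /p mulgK.
have pE : p = cnext (porbit p).
  by apply: noncrossing_kreweras_cnext; exact: noncrossing_pblock.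
exists p; last by rewrite kp nuE.
rewrite inE -pE eqxx kp; apply/and4P; split=> //; first exact/forallP.
  by rewrite des_type_Rem // nuE bs.
rewrite pE card_porbits_cnext -pE kp eqSS -sum_des.
(* One ascent per block: descents and blocks together exhaust the [k.+1] times. *)
have : \sum_(C in porbits s) des s C + #|nu| = k.+1.
  rewrite -[in RHS](card_ord k.+1) -(card_porbits_sum s) -nuE -sum1_card -big_split /=.
  by apply: eq_bigr => C CP; rewrite addn1 dC.
have -> : #|nu| = size mu by rewrite -bs size_sort size_map -cardE.
by lia.
Qed.

(** * Counting walks *)

(** A walk with kernel [p] is an injection of the orbits of [p] into the vertices. *)
Lemma card_cnext_fiber (V : finType) k (p : {perm 'I_k.+1}) : p = cnext (porbit p) ->
  #|[set i : {ffun 'I_k.+1 -> V} | cnext i == p]| = #|V| ^_ #|porbits p|.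
Proof.
move=> pE; pose D : finType := {C : {set 'I_k.+1} | C \in porbits p}.
have cD : #|D| = #|porbits p| by rewrite /D card_sig.
pose cl j : D := exist _ (porbit p j) (mem_porbits p j).
pose F (f : {ffun D -> V}) : {ffun 'I_k.+1 -> V} := [ffun j => f (cl j)].
have clS (C : D) : exists j, C = cl j.
  case: C => C CP; case/imsetP: (CP) => j _ e; exists j.
  exact: val_inj.
have FI : injective F.
  move=> f f' /ffunP e; apply/ffunP => C; have [j ->] := clS C.
  by have := e j; rewrite !ffunE.
rewrite -cD -card_inj_ffuns -(card_imset _ FI); apply: eq_card => i.
rewrite inE; apply/eqP/imsetP => [e|[f]].
  pose dv (C : D) : {set 'I_k.+1} := sval C.
  (* The vertex of an orbit is read at any representative; orbits being nonempty, the default [ord0]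
     never arises. *)
  pose f : {ffun D -> V} := [ffun C : D => i (odflt ord0 [pick j in dv C])].
  have fE j : f (cl j) = i j.
    rewrite ffunE /=; case: pickP => [u|/(_ j)]; last by rewrite porbit_id.
    by rewrite -e cnext_porbitP => /eqP.
  exists f; last by apply/ffunP => j; rewrite ffunE fE.
  rewrite inE; apply/injectiveP => C C'; have [j ->] := clS C; have [u ->] := clS C'.
  rewrite !fE => eij; apply: val_inj; apply/eqP.
  by rewrite /= eq_porbit_mem -e cnext_porbitP eij.
rewrite inE => /injectiveP fI ->; rewrite [RHS]pE; apply: eq_cnext => j u.
by rewrite !ffunE (inj_eq fI).
Qed.

Lemma card_nonzero_fiber n k (p : {perm 'I_k.+1}) : p = cnext (porbit p) ->
  #|[set i : {ffun 'I_k.+1 -> 'I_n.+1} | [forall j, i j != ord0] && (cnext i == p)]|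
  = n ^_ #|porbits p|.
Proof.
move=> pE; rewrite -[in RHS](card_ord n) -(card_cnext_fiber 'I_n pE).
pose L (g : {ffun 'I_k.+1 -> 'I_n}) : {ffun 'I_k.+1 -> 'I_n.+1} := [ffun j => lift ord0 (g j)].
have LI : injective L.
  move=> f f' /ffunP e; apply/ffunP => j; have := e j; rewrite !ffunE.
  exact: lift_inj.
have nxL g : cnext (L g) = cnext g by apply: eq_cnext => j u; rewrite !ffunE (inj_eq lift_inj).
rewrite -(card_imset _ LI); apply: eq_card => i; rewrite inE.
apply/andP/imsetP => [[/forallP nz /eqP e]|[g]]; last first.
  rewrite inE => /eqP e ->; rewrite nxL e eqxx; split=> //.
  by apply/forallP => j; rewrite ffunE eq_sym neq_lift.
have [g eg] := nonzero_lift nz; have eL : i = L g by apply/ffunP => j; rewrite ffunE eg.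
by exists g => //; rewrite inE -nxL -eL e.
Qed.

Lemma leq_ffact_expn n m : n ^_ m <= n ^ m.
Proof.
elim: m => [|m IH]; first by rewrite ffactn0.
by rewrite ffactnSr expnSr leq_mul // leq_subr.
Qed.

(** Each step trades a factor [n] for [n - m.+1], which costs at most [m.+1 * n ^ m.+1]. *)
Lemma leq_expn_ffact n m : n ^ m.+1 <= n ^_ m.+1 + m.+1 ^ 2 * n ^ m.
Proof.
elim: m => [|m IH]; first by rewrite ffactn1 expn1 leq_addr.
have a := leq_ffact_expn n m.+1.
rewrite ffactnSr [n ^ m.+2]expnSr; set x := n ^ m.+1 in IH a *; set y := n ^_ m.+1 in IH a *.
have b : x * n <= y * n + m.+1 ^ 2 * x.
  apply: leq_trans (leq_mul IH (leqnn n)) _.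
  by rewrite mulnDl -mulnA -expnSr.
apply: leq_trans b _.
have c : y * n <= y * (n - m.+1) + y * m.+1 by rewrite -mulnDr leq_mul //; lia.
have d : y * m.+1 <= x * m.+1 by rewrite leq_mul.
nia.
Qed.

(** The difference counts the injections of [m.+1] points that hit one marked value: choose which
    point hits it. *)
Lemma ffactS_sub n m : n.+1 ^_ m.+1 - n ^_ m.+1 <= m.+1 * n ^ m.
Proof.
rewrite ffactSS ffactnSr.
have a := leq_ffact_expn n m.
have [le|lt] := leqP m n; last by rewrite ffact_small // muln0.
have b : n.+1 * n ^_ m - n ^_ m * (n - m) = m.+1 * n ^_ m.
  by rewrite [n ^_ m * _]mulnC -mulnBl; congr (_ * _); lia.
by rewrite b leq_mul.
Qed.

Lemma leq_sum_const (T : finType) (P : pred T) x : \sum_(p | P p) x <= #|T| * x.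
Proof.
have -> : \sum_(p | P p) x = #|P| * x by rewrite -sum_nat_const.
by rewrite leq_mul // max_card.
Qed.

(** * Asymptotics of the coefficients *)

Definition nwalks n k lam : nat :=
  #|[set i : {ffun 'I_k -> 'I_n.+1} | admissible i && (cycle_type2 (cyc_prod i) == lam)]|.

Lemma Ncoef_nwalks n k lam : Ncoef lam (Dk n k) = ((nwalks n k lam)%:R / n.+1%:R)%R.
Proof.
rewrite /Ncoef /Dk; under eq_bigr do rewrite ffunE.
rewrite -mulr_suml -natr_sum; congr (_%:R / _)%R.
rewrite /nwalks -sum1_card.
rewrite (partition_big (fun i : {ffun 'I_k -> 'I_n.+1} => cyc_prod i)
   (fun s => cycle_type2 s == lam)) /=; last by move=> i; rewrite inE => /andP[].
apply: eq_bigr => s /eqP es; rewrite -sum1_card; apply: eq_bigl => i; rewrite !inE.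
by case: eqP => [->|_]; rewrite ?andbF // es eqxx !andbT.
Qed.

Lemma card_nonzero_walks n k lam :
  #|[set i : {ffun 'I_k.+1 -> 'I_n.+1} | [&& admissible i, cycle_type2 (cyc_prod i) == lam
     & [forall j, i j != ord0]]]| =
  \sum_(p : {perm 'I_k.+1} | [&& p == cnext (porbit p), [forall j, kreweras p j != j]
     & des_type (kreweras p) == lam]) n ^_ #|porbits p|.
Proof.
rewrite -sum1_card (partition_big (fun i : {ffun 'I_k.+1 -> 'I_n.+1} => cnext i)
   (fun p => [&& p == cnext (porbit p), [forall j, kreweras p j != j]
     & des_type (kreweras p) == lam])) /=.
  apply: eq_bigr => p /and3P[/eqP pE nf /eqP dE].
  rewrite -(card_nonzero_fiber n pE) -sum1_card; apply: eq_bigl => i; rewrite !inE.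
  case: (cnext i =P p) => [e|_]; rewrite ?andbF // !andbT.
  rewrite admissible_kreweras e nf /=; case nz : [forall j, _]; rewrite ?andbF // andbT.
  by rewrite cyc_prod_nonzero_type ?admissible_kreweras ?e ?dE ?eqxx //; exact/forallP.
move=> i; rewrite inE => /and3P[ad /eqP ty /forallP nz].
by rewrite cnext_porbit eqxx -admissible_kreweras ad -cyc_prod_nonzero_type // ty eqxx.
Qed.

(** For each kernel, subtract the walks avoiding 0 from all walks: the leading terms cancel, which
    saves one power of [n]. *)
Lemma card_zero_walks n k lam e :
  (forall i : {ffun 'I_k.+1 -> 'I_n.+1}, admissible i -> cycle_type2 (cyc_prod i) = lam ->
     #|porbits (cnext i)| <= e.+1) -> 0 < n ->
  #|[set i : {ffun 'I_k.+1 -> 'I_n.+1} | [&& admissible i, cycle_type2 (cyc_prod i) == lam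
     & ~~ [forall j, i j != ord0]]]| <= #|{perm 'I_k.+1}| * (e.+1 * n ^ e).
Proof.
move=> bd n0.
rewrite -sum1_card (partition_big (fun i : {ffun 'I_k.+1 -> 'I_n.+1} => cnext i)
   (fun p => (p == cnext (porbit p)) && (#|porbits p| <= e.+1))) /=; last first.
  by move=> i; rewrite inE => /and3P[ad /eqP ty _]; rewrite cnext_porbit eqxx bd.
apply: (@leq_trans (\sum_(p : {perm 'I_k.+1} | (p == cnext (porbit p)) && (#|porbits p| <= e.+1))
    e.+1 * n ^ e)); last first.
  exact: leq_sum_const.
apply: leq_sum => p /andP[/eqP pE le].
have [m bE] : exists m, #|porbits p| = m.+1.
  exists #|porbits p|.-1; rewrite prednK //; apply/card_gt0P; exists (porbit p ord0).
  exact: mem_porbits.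
apply: (@leq_trans (n.+1 ^_ #|porbits p| - n ^_ #|porbits p|)); last first.
  rewrite bE; apply: leq_trans (ffactS_sub n m) _; rewrite bE in le.
  by rewrite leq_mul // leq_pexp2l.
rewrite -(card_nonzero_fiber n pE) -[X in X ^_ _](card_ord n.+1) -(card_cnext_fiber 'I_n.+1 pE).
rewrite leq_subRL; last by apply: subset_leq_card; apply/subsetP => i; rewrite !inE => /andP[].
rewrite sum1_card -cardsE -[X in _ <= X](cardsID [set i : {ffun 'I_k.+1 -> 'I_n.+1} |
  [forall j, i j != ord0]]).
apply: leq_add; apply: subset_leq_card; apply/subsetP => i; rewrite !inE.
  by case/andP=> -> ->.
by case/andP; rewrite inE => /and3P[_ _ ->] ->.
Qed.

(** The main term carries the factor [n.+1] because the coefficient divides the count by it. *)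
Lemma nwalks_asymp k mu (e := k.+1 - size mu) (c := #|NC k.+1 mu|) : Ybar k.+1 mu ->
  exists C, forall n, 0 < n ->
    nwalks n k.+1 (Rem mu) <= c * (n ^ e * n.+1) + C * n ^ e /\
    c * (n ^ e * n.+1) <= nwalks n k.+1 (Rem mu) + C * n ^ e.
Proof.
move=> Y; have [sumE sizeE] := Rem_sum Y.
pose K := #|{perm 'I_k.+1}|.
(* In order, the errors come from replacing the falling factorial by a power, from [n.+1] against
   [n], from non-extremal kernels, and from walks through 0. *)
exists (c * e.+1 ^ 2 + c + K + K * e.+1) => n n0.
set Z := [set i : {ffun 'I_k.+1 -> 'I_n.+1} | [&& admissible i, cycle_type2 (cyc_prod i) == Rem mu
     & ~~ [forall j, i j != ord0]]].
pose G2 (p : {perm 'I_k.+1}) := [&& p == cnext (porbit p), [forall j, kreweras p j != j],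
   des_type (kreweras p) == Rem mu & #|porbits p| != e.+1].
have WE : nwalks n k.+1 (Rem mu) = c * n ^_ e.+1 + \sum_(p | G2 p) n ^_ #|porbits p| + #|Z|.
  rewrite /nwalks -(cardsID [set i : {ffun 'I_k.+1 -> 'I_n.+1} | [forall j, i j != ord0]]).
  congr (_ + _); last by apply: eq_card => i; rewrite !inE andbC -andbA.
  transitivity (\sum_(p : {perm 'I_k.+1} | [&& p == cnext (porbit p), [forall j, kreweras p j != j]
     & des_type (kreweras p) == Rem mu]) n ^_ #|porbits p|).
    by rewrite -card_nonzero_walks; apply: eq_card => i; rewrite !inE -andbA.
  rewrite (bigID (fun p : {perm 'I_k.+1} => #|porbits p| == e.+1)) /=; congr (_ + _).
    rewrite (eq_bigr (fun=> n ^_ e.+1)); last by move=> p /andP[_ /eqP ->].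
    rewrite sum_nat_const /c -(card_extremal_kreweras Y) -/e; congr (_ * _).
    by apply: eq_card => p; rewrite [RHS]inE unfold_in /= -!andbA.
  by apply: eq_bigl => p; rewrite /G2 -!andbA.
have Zle : #|Z| <= K * (e.+1 * n ^ e).
  apply: card_zero_walks => // i ad ty.
  by have [_ _] := cyc_prod_bounds ad; rewrite ty; rewrite /e; lia.
have G2le : \sum_(p | G2 p) n ^_ #|porbits p| <= K * n ^ e.
  apply: (@leq_trans (\sum_(p | G2 p) n ^ e)); last first.
    exact: leq_sum_const.
  apply: leq_sum => p /and4P[/eqP pE /forallP nf /eqP dE ne].
  apply: leq_trans (leq_ffact_expn _ _) _; rewrite leq_pexp2l //.
  have := des_type_bound nf; rewrite dE.
  by move: ne; rewrite [in porbits p]pE card_porbits_cnext -pE /e; lia.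
have f1 := leq_ffact_expn n e.+1; have f2 := leq_expn_ffact n e.
rewrite expnS in f1 f2.
have g1 : c * n ^_ e.+1 <= c * (n * n ^ e) by rewrite leq_mul.
have g2 : c * (n * n ^ e) <= c * n ^_ e.+1 + c * (e.+1 ^ 2 * n ^ e).
  by rewrite -mulnDr leq_mul.
set X := n ^ e in Zle G2le g1 g2 *; rewrite WE.
have -> : c * (X * n.+1) = c * (n * X) + c * X by rewrite mulnS mulnDr addnC [X * n]mulnC.
have -> : (c * e.+1 ^ 2 + c + K + K * e.+1) * X =
  c * (e.+1 ^ 2 * X) + c * X + K * X + K * (e.+1 * X) by rewrite !mulnDl !mulnA.
by split; lia.
Qed.

Lemma size_Rem_le k mu : Ybar k mu -> size (Rem mu) <= sumn (Rem mu).
Proof.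
case/andP=> /andP[_ ge2] _; have : all (fun x => 0 < x) (Rem mu).
  apply/allP => x /mapP[y]; rewrite mem_filter => /andP[_ /(allP ge2)] + ->.
  by case: y => [|[]].
elim: (Rem mu) => //= x l IH /andP[x0 /IH]; lia.
Qed.

Theorem mainTheorem5 (R : realType) (k : nat) (hk : (2 <= k)%N) :
  (* (i) *)
  (forall (n : nat) (lam : seq nat), (1 <= n)%N -> is_part2 lam ->
     (forall mu, Ybar k mu -> lam <> Rem mu) ->
     Ncoef lam (Dk n k) = 0%R)
  /\
  (* (ii) *)
  (forall mu : seq nat, Ybar k mu ->
     let lam := Rem mu in
     let s (n : nat) : R := Num.sqrt ((n%:R : R) ^+ (pl lam + k)) in
     exists C : R, exists N0 : nat, forall n : nat, (N0 <= n)%N ->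
       (`| ratr (Ncoef lam (Dk n k)) - (#|NC k mu|%:R * s n) | <= C * (s n / n%:R))%R).
Proof.
case: k hk => // k _; split=> [n lam _ part2 noRem|mu Y lam s].
  rewrite Ncoef_nwalks; have -> : nwalks n k.+1 lam = 0; last by rewrite mul0r.
  apply/eqP; rewrite cards_eq0; apply/eqP/setP => i; rewrite !inE; apply/negP => /andP[ad /eqP ty].
  have [le par _] := cyc_prod_bounds ad; rewrite ty in le par.
  (* By parity the slack is even; half of it is the number of parts 2 to restore. *)
  have eqk : sumn lam + size lam + 2 * (k.+1 - (sumn lam + size lam))./2 = k.+1 by lia.
  have [mu Ymu e] := Rem_exists part2 eqk.
  exact: noRem mu Ymu e.
have [sumE sizeE] := Rem_sum Y; have leS := size_Rem_le Y.
have [C HC] := nwalks_asymp Y; exists C%:R%R, 1 => n n0.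
have [] := HC n n0; set e := k.+1 - size mu; set c := #|_|; set W := nwalks _ _ _ => up lo.
have -> : s n = (n%:R ^+ e)%R.
  (* The subtraction in [pl] is exact by [leS], and the exponent is twice [e], so the square root is
     a plain power. *)
  rewrite /s; have -> : pl lam + k.+1 = e * 2 by rewrite /pl /psize /plength /lam /e; lia.
  by rewrite exprM sqrtr_sqr ger0_norm // exprn_ge0.
rewrite Ncoef_nwalks -/W fmorph_div /= !rmorph_nat.
have n1 : (0 < n.+1%:R :> R)%R by rewrite ltr0n.
have nR : (0 < n%:R :> R)%R by rewrite ltr0n.
have X0 : (0 <= n%:R ^+ e :> R)%R by rewrite exprn_ge0 // ltW.
have key : (`|W%:R - c%:R * n%:R ^+ e * n.+1%:R| <= C%:R * n%:R ^+ e :> R)%R.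
  rewrite ler_norml lerBrDr addrC lerBlDr lerBlDr -!natrX -!natrM -!natrD !ler_nat.
  by rewrite mulnA in up lo; apply/andP; split; lia.
(* Put the difference over [n.+1]; the error [C * n ^ e / n.+1] is then at most [C * n ^ e / n]. *)
rewrite -[X in (`|_ - X|)%R](mulfK (lt0r_neq0 n1)) -mulrBl normrM (@ger0_norm _ n.+1%:R^-1%R) ?invr_ge0 ?ler0n //.
apply: (@le_trans _ _ (C%:R * n%:R ^+ e / n.+1%:R)%R).
  by apply: ler_wpM2r key; rewrite invr_ge0 ltW.
rewrite -mulrA ler_wpM2l ?ler0n // ler_wpM2l // lef_pV2 ?posrE // ler_nat.
exact: leqnSn.
Qed.
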